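(* Let $\mathcal{G}$ be the class of all spiral structures, regarded as finite structures in the language $\{R\}$ with one binary relation symbol. (1) $\mathcal{G}$ is a projective Fraïssé family. (2) The projective Fraïssé limit of $\mathcal{G}$ is a generic homeomorphism of the Cantor set; that is, if $(\mathbb{L},R^{\mathbb{L}})$ is the projective Fraïssé limit of $\mathcal{G}$, then $\mathbb{L}$ is homeomorphic to the Cantor set and $R^{\mathbb{L}}$ is the graph of a homeomorphism $F^{\mathbb{L}}$ of $\mathbb{L}$ whose conjugacy class $\{gF^{\mathbb{L}}g^{-1}: g\in H(\mathbb{L})\}$ is comeager in the homeomorphism group $H(\mathbb{L})$.
   Context: A spiral is a set $N=\{1,2,\ldots,n\}$ with two distinguished points $x_N,y_N$ such that $1<x_N<y_N<n$, equipped with the binary relation $R^N$ consisting exactly of the pairs $(i,i+1)$ for $i=1,\ldots,n-1$ together with $(x_N,1)$ and $(n,y_N)$. A spiral structure is a disjoint union of finitely many (at least one) spirals, with no relations between different components. A topological $\{R\}$-structure is a compact zero-dimensional second-countable (Hausdorff) space $A$ equipped with a closed binary relation $R^A\subseteq A^2$; finite structures carry the discrete topology. A continuous surjection $\phi\colon B\to A$ between such structures is an epimorphism if for all $x_1,x_2\in A$: $(x_1,x_2)\in R^A$ if and only if there are $y_1,y_2\in B$ with $\phi(y_1)=x_1$, $\phi(y_2)=x_2$ and $(y_1,y_2)\in R^B$. An isomorphism is a bijective epimorphism. A family $\mathcal{F}$ of finite topological structures is a projective Fraïssé family if: (F1) (JPP) for any $A,B\in\mathcal{F}$ there are $C\in\mathcal{F}$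 and epimorphisms from $C$ onto $A$ and from $C$ onto $B$; (F2) (AP) for $A,B_1,B_2\in\mathcal{F}$ and epimorphisms $\phi_1\colon B_1\to A$, $\phi_2\colon B_2\to A$ there are $C\in\mathcal{F}$ and epimorphisms $\phi_3\colon C\to B_1$, $\phi_4\colon C\to B_2$ with $\phi_1\circ\phi_3=\phi_2\circ\phi_4$. A topological structure $\mathbb{L}$ is a projective Fraïssé limit of $\mathcal{F}$ if: (L1) for any $A\in\mathcal{F}$ there is an epimorphism from $\mathbb{L}$ onto $A$; (L2) for any finite discrete space $X$ and continuous $f\colon\mathbb{L}\to X$ there are $A\in\mathcal{F}$, an epimorphism $\phi\colon\mathbb{L}\to A$ and a function $f_0\colon A\to X$ with $f=f_0\circ\phi$; (L3) for any $A\in\mathcal{F}$ and epimorphisms $\phi_1,\phi_2\colon\mathbb{L}\to A$ there is an isomorphism $\psi\colon\mathbb{L}\to\mathbb{L}$ with $\phi_2=\phi_1\circ\psi$. By a theorem of Irwin and Solecki, every projective Fraïssé family that is countable (up to isomorphism) has a projective Fraïssé limit, unique up to isomorphism. $H(\mathbb{L})$ carries the topology of uniform convergence. A homeomorphism of the Cantor set is generic if its conjugacy class is comeager. *)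

(* Defs.v *)
From HB Require Import structures.
From mathcomp Require Import all_boot all_order all_algebra.
From mathcomp Require Import all_classical all_reals all_analysis.

Set Implicit Arguments.
Unset Strict Implicit.
Unset Printing Implicit Defensive.

Local Open Scope classical_set_scope.

Record rstructure := RStructure {
  rs_sort :> topologicalType;
  rs_rel : set (rs_sort * rs_sort) }.

(* For a compact Hausdorff space, [zero_dimensional] (distinct points are
   separated by a clopen set) amounts to having a basis of clopen sets. *)
Definition topological_structure (A : rstructure) : Prop :=
  [/\ compact [set: A], hausdorff_space A, zero_dimensional A,
      @second_countable A & closed (@rs_rel A)].

Record fin_structure := FinStructure {
  fs_sort :> finType;
  fs_rel : rel fs_sort }.

Definition discrete_structure (A : fin_structure) : rstructure :=
  @RStructure (discrete_topology A) [set p | @fs_rel A p.1 p.2].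

Coercion discrete_structure : fin_structure >-> rstructure.

Lemma fin_topological_structure (A : fin_structure) : topological_structure A.
Proof.
split.
- exact/finite_compact/(@finite_finset A).
- exact: (@discrete_hausdorff (discrete_topology A)).
- exact: (@discrete_zero_dimension (discrete_topology A)).
- exists (range (fun x : A => [set x])).
    exact/finite_set_countable/finite_image/(@finite_finset A).
  split=> [U _|x U Ux]; first exact: (@discrete_open (discrete_topology A)).
  exists [set x]; first by split => //; exists x.
  by move=> _ ->; exact: (nbhs_singleton Ux).
- have discA (x : rs_sort A) : nbhs x [set x].
    exact: (@discrete_set1 (discrete_topology A)).
  have opA (U : set (rs_sort A * rs_sort A)) : open U.
    rewrite openE => -[x y] Uxy; exists ([set x], [set y]) => //.
    by case=> x' y' [/= -> ->].
  by rewrite -(setCK (@rs_rel A)); exact: open_closedC.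
Qed.

Definition epimorphism (B A : rstructure) (phi : B -> A) : Prop :=
  [/\ continuous phi,
      (forall x : A, exists y : B, phi y = x) &
      forall x1 x2 : A, rs_rel (x1, x2) <->
        exists y1 y2 : B, [/\ phi y1 = x1, phi y2 = x2 & rs_rel (y1, y2)]].

Definition isomorphism (B A : rstructure) (phi : B -> A) : Prop :=
  epimorphism phi /\ bijective phi.

Definition joint_projection (F : fin_structure -> Prop) : Prop :=
  forall A B : fin_structure, F A -> F B ->
    exists C : fin_structure, F C /\
      (exists phi : C -> A, @epimorphism C A phi) /\
      (exists psi : C -> B, @epimorphism C B psi).

Definition proj_amalgamation (F : fin_structure -> Prop) : Prop :=
  forall (A B1 B2 : fin_structure) (phi1 : B1 -> A) (phi2 : B2 -> A),
    F A -> F B1 -> F B2 ->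
    @epimorphism B1 A phi1 -> @epimorphism B2 A phi2 ->
    exists (C : fin_structure) (phi3 : C -> B1) (phi4 : C -> B2),
      [/\ F C, @epimorphism C B1 phi3, @epimorphism C B2 phi4 &
          phi1 \o phi3 = phi2 \o phi4].

Definition proj_fraisse_family (F : fin_structure -> Prop) : Prop :=
  joint_projection F /\ proj_amalgamation F.

Definition proj_fraisse_limit (F : fin_structure -> Prop) (L : rstructure) :
    Prop :=
  [/\ topological_structure L,
      (forall A : fin_structure, F A ->
         exists phi : L -> A, @epimorphism L A phi),
      (forall (X : finType) (f : L -> discrete_topology X), continuous f ->
         exists (A : fin_structure) (phi : L -> A) (f0 : A -> X),
           [/\ F A, @epimorphism L A phi & f = f0 \o phi]) &
      (forall (A : fin_structure) (phi1 phi2 : L -> A), F A ->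
         @epimorphism L A phi1 -> @epimorphism L A phi2 ->
         exists psi : L -> L, isomorphism psi /\ phi2 = phi1 \o psi)].

(* The underlying set {1, ..., n} is represented by 'I_n, the ordinal i standing
   for i + 1; thus 1 is the ordinal 0, n is the ordinal n.-1, and
   1 < x < y < n becomes 0 < x < y < n.-1. *)
Record spiral := Spiral {
  spiral_size : nat;
  spiral_x : 'I_spiral_size;
  spiral_y : 'I_spiral_size;
  spiral_xyP : [/\ (0 < spiral_x)%N, (spiral_x < spiral_y)%N &
                   (spiral_y < spiral_size.-1)%N] }.

Definition spiral_rel (N : spiral) : rel 'I_(spiral_size N) := fun i j =>
  [|| j == i.+1 :> nat,
      (i == spiral_x N) && (j == 0 :> nat) |
      (i == (spiral_size N).-1 :> nat) && (j == spiral_y N)].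

Definition spiral_union (k : nat) (S : 'I_k -> spiral) : fin_structure :=
  @FinStructure {c : 'I_k & 'I_(spiral_size (S c))}
    (fun u v => (tag u == tag v) && spiral_rel (tagged u) (tagged_as u v)).

Definition spiral_structures (A : fin_structure) : Prop :=
  exists (k : nat) (S : 'I_k -> spiral), (0 < k)%N /\
    exists phi : A -> spiral_union S, @isomorphism A (spiral_union S) phi.

Definition homeomorphism (S T : topologicalType) (f : S -> T) : Prop :=
  continuous f /\
  exists g : T -> S, [/\ continuous g, cancel f g & cancel g f].

(* A compact Hausdorff space has a unique compatible uniformity, so giving it as
   a [uniformType] amounts to giving its topology. The set [homeo_group L],
   coerced to a type, carries the subspace topology of {uniform L -> L}, i.e. the
   topology of uniform convergence. *)
Definition homeo_group (L : uniformType) : set {uniform L -> L} :=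
  [set f | homeomorphism (f : L -> L)].
Arguments homeo_group : clear implicits.

Definition homeo_fun (L : uniformType) (f : homeo_group L) : L -> L := \val f.

Definition conjugacy_class (L : uniformType) (F : homeo_group L) :
    set (homeo_group L) :=
  [set G | exists g ginv : homeo_group L,
     [/\ cancel (homeo_fun g) (homeo_fun ginv),
         cancel (homeo_fun ginv) (homeo_fun g) &
         homeo_fun G = homeo_fun g \o homeo_fun F \o homeo_fun ginv]].

Definition nowhere_dense (T : topologicalType) (A : set T) : Prop :=
  interior (closure A) = set0.

Definition meager (T : topologicalType) (A : set T) : Prop :=
  exists N : nat -> set T,
    (forall n, nowhere_dense (N n)) /\ A = \bigcup_n N n.

Definition comeager (T : topologicalType) (A : set T) : Prop := meager (~` A).

(* Main.v *)
Require Import Defs.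
From mathcomp Require Import all_boot all_order all_algebra.
From mathcomp Require Import all_classical all_reals all_analysis.
From mathcomp Require Import zify.

(** A spiral is what a long walk in a finite directed graph looks like: by the
pigeonhole principle the walk repeats itself both near its beginning and near
its end, and closing it up at the repetitions gives a first cycle, a path
leaving it and a path entering a last cycle. So any finite graph whose relevant
edges lie in the middle of long walks receives a homomorphism from a spiral
structure which covers those edges ([spiral_cover]). All constructions of
spiral structures below are instances of this.

For joint projection and amalgamation, the graph is the product, respectively
the fibre product, of the two given structures. Amalgamation requires walks to
lift along epimorphisms. In a spiral the points of the first cycle have a
single predecessor and the remaining points a single successor, and a walk can
only pass from the former to the latter; hence a walk is determined backwards
and forwards by the edge at which it leaves the first cycle, and it suffices to
lift this edge and extend ([walk_lifting]).

In the limit, every structure is refined by one in which all points have two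
preimages and in which the successors of a point, and its predecessors, become
identified in the given structure ([spiral_splitting]). The first property
excludes isolated points, the second makes the relation and its inverse
single-valued; being closed and total, the relation is the graph of a
homeomorphism F. Compact zero-dimensional second-countable spaces without
isolated points are homeomorphic by a back-and-forth argument
([perfect_stone_homeomorphism]), whence the Cantor set.

The same back-and-forth ([back_and_forth]), now with maps that are epimorphisms
onto spiral structures, shows that a homeomorphism G of the limit space is
conjugate to F as soon as every locally constant map factors through an
epimorphism for G onto a spiral structure, and every such epimorphism lifts
along epimorphisms between spiral structures ([generic],
[generic_conjugate]). Each of the countably many instances of these conditions
is open in the homeomorphism group, as it only involves finitely many clopen
sets, and F and its conjugates satisfy them. So the conjugacy class is a
countable intersection of open sets, and only its density is left. Near a
homeomorphism G there is a conjugate of F because the finite graph that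
describes how G moves the pieces of a clopen partition is covered by the orbits
of G, so it is an image of a spiral structure and therefore of F; a
homeomorphism which matches the two partitions conjugates F close to G
([limit_conjugacy_class_dense]). *)

Set Implicit Arguments.
Unset Strict Implicit.
Unset Printing Implicit Defensive.

Local Open Scope classical_set_scope.

(** * Walks in finite structures, and the spiral structures they span *)

Lemma discrete_dom_continuous (X : choiceType) (T : topologicalType)
  (f : discrete_topology X -> T) : continuous f.
Proof.
move=> x U fxU; have xx : nbhs x [set x] by exact: discrete_set1.
have xU : [set x] `<=` f @^-1` U by move=> y ->; exact: (nbhs_singleton fxU).
exact: (@filterS (discrete_topology X) (nbhs x) _ _ _ xU xx).
Qed.

Lemma fin_epimorphismP (B A : fin_structure) (phi : B -> A) :
  @epimorphism B A phi <->
  [/\ forall b b', fs_rel b b' -> fs_rel (phi b) (phi b'),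
      forall a, exists b, phi b = a &
      forall a a', fs_rel a a' ->
        exists b b', [/\ phi b = a, phi b' = a' & fs_rel b b']].
Proof.
split=> [[_ surj rel]|[hom surj rel]].
  split=> // [b b' bb'|a a' /rel//].
  by apply/(rel (phi b) (phi b')); exists b, b'.
split=> //; first exact: discrete_dom_continuous.
move=> a a'; split=> [/rel //|[b [b' [<- <- /hom]]]] //.
Qed.

Lemma epimorphism_comp (C B A : rstructure) (psi : C -> B) (phi : B -> A) :
  epimorphism psi -> epimorphism phi -> epimorphism (phi \o psi).
Proof.
move=> [psic psis psiR] [phic phis phiR]; split.
- by move=> x; apply: continuous_comp; [exact: psic|exact: phic].
- by move=> a; have [b <-] := phis a; have [c <-] := psis b; exists c.
- move=> a a'; split=> [/phiR[b [b' [<- <- /psiR]]]|].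
    by move=> [c [c' [<- <- cc']]]; exists c, c'.
  move=> [c [c' [<- <- cc']]]; apply/phiR; exists (psi c), (psi c'); split=> //.
  by apply/psiR; exists c, c'.
Qed.

Lemma isomorphism_id (A : rstructure) : @isomorphism A A id.
Proof.
split; last by exists id.
split; [by move=> a; exact: cvg_id|by move=> a; exists a|].
by move=> a a'; split=> [aa'|[b [b' [/= -> -> //]]]]; exists a, a'.
Qed.

Section walks.
Variables (D : Type) (E : D -> D -> Prop).

Definition walk m (w : nat -> D) := forall t, (t < m)%N -> E (w t) (w t.+1).

Definition extendable := forall d, (exists d', E d d') /\ (exists d', E d' d).

(** A finite substitute for a bi-infinite orbit through the edge from [d] to
[d']. *)
Definition window K (d d' : D) :=
  exists2 w : nat -> D, walk K.*2.+1 w & w K = d /\ w K.+1 = d'.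

Lemma extendable_window K d d' : extendable -> E d d' -> window K d d'.
Proof.
move=> extE dd'.
have [s sP] := choice (fun d => (extE d).1).
have [p pP] := choice (fun d => (extE d).2).
exists (fun t => if (t <= K)%N then iter (K - t) p d else iter (t - K.+1) s d').
  move=> t _; case: (ltngtP t K) => [tK|Kt|->].
  - rewrite -(subnSK tK) /=; exact: pP.
  - rewrite subSn //; exact: sP.
  - by rewrite !subnn.
by rewrite leqnn ltnn !subnn.
Qed.

Lemma extendable_walk m d : extendable -> exists2 w, walk m w & w 0 = d.
Proof.
move=> extE; have [s sP] := choice (fun d => (extE d).1).
by exists (fun t => iter t s d) => // t _; exact: sP.
Qed.

End walks.

(** Maps with this property are what forces the relation of the limit to be
single-valued in both directions. *)
Definition coherent (C : fin_structure) (D : Type) (h : C -> D) :=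
  (forall c c1 c2, fs_rel c c1 -> fs_rel c c2 -> h c1 = h c2) /\
  (forall c c1 c2, fs_rel c1 c -> fs_rel c2 c -> h c1 = h c2).

Definition spiral_structure (N : spiral) : fin_structure :=
  @FinStructure 'I_(spiral_size N) (@spiral_rel N).

(** The stretch of the walk from [i.+1] to [l] becomes a spiral once position
[j] is followed by [i.+1] and position [l] by [k]. Since the two repetitions
are repetitions of pairs of consecutive values, closing up changes neither
successors nor predecessors in the image, which gives coherence. *)
Lemma spiral_of_walk (D : Type) (E : D -> D -> Prop) (w : nat -> D) i j k l :
    (i.+1 < j)%N -> (j < k)%N -> (k < l)%N ->
    w i = w j -> w i.+1 = w j.+1 -> w k.-1 = w l -> w k = w l.+1 ->
    walk E l.+1 w ->
  exists (N : spiral) (h : spiral_structure N -> D),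
    [/\ forall u v, fs_rel u v -> E (h u) (h v), coherent h &
        forall t, (i < t < l)%N ->
          exists u v, [/\ fs_rel u v, h u = w t & h v = w t.+1]].
Proof.
move=> ij jk kl wij wij1 wkl wkl1 wE.
have xn : (j - i.+1 < l - i)%N by lia.
have yn : (k - i.+1 < l - i)%N by lia.
have xyP : [/\ (0 < Ordinal xn)%N, (Ordinal xn < Ordinal yn)%N &
    (Ordinal yn < (l - i).-1)%N] by split => /=; lia.
pose N := Spiral xyP; pose h (v : spiral_structure N) := w (i.+1 + v)%N.
(* Both formulas compute neighbours in the spiral as neighbours in the walk. *)
have hs (u v : spiral_structure N) : fs_rel u v -> h v = w (i.+1 + u).+1.
  rewrite /h => /or3P[/eqP->|/andP[/eqP-> /eqP->]|/andP[/eqP-> /eqP->]] /=.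
  - by rewrite addnS.
  - by rewrite addn0 wij1; congr w; lia.
  - have -> : (i.+1 + (k - i.+1) = k)%N by lia.
    by rewrite wkl1; congr w; lia.
have hp (u v : spiral_structure N) : fs_rel u v -> h u = w (i + v)%N.
  rewrite /h => /or3P[/eqP->|/andP[/eqP-> /eqP->]|/andP[/eqP-> /eqP->]] /=.
  - by rewrite addnS.
  - by rewrite addn0 wij; congr w; lia.
  - have -> : (i + (k - i.+1) = k.-1)%N by lia.
    by rewrite wkl; congr w; lia.
exists N, h; split=> [u v uv||t /andP[it tl]].
- by rewrite (hs _ _ uv); apply: wE; have un : (u < l - i)%N := ltn_ord u; lia.
- by split=> c c1 c2; [move=> /hs-> /hs->|move=> /hp-> /hp->].
- have tn : (t - i.+1 < l - i)%N by lia.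
  have tn1 : (t - i < l - i)%N by lia.
  exists (Ordinal tn : spiral_structure N), (Ordinal tn1 : spiral_structure N).
  split; last 2 first.
  + by rewrite /h /=; congr w; lia.
  + by rewrite /h /=; congr w; lia.
  + by apply/or3P/Or31/eqP => /=; lia.
Qed.

(** Only every other position is sampled, so that two sampled positions are
never adjacent: the cycles of a spiral have at least two points. *)
Lemma repeated_pair (D : finType) (w : nat -> D) b :
  exists i j, [/\ (b <= i)%N, (i.+1 < j)%N, (j <= b + #|{: D * D}|.*2)%N,
    w i = w j & w i.+1 = w j.+1].
Proof.
set M := #|{: D * D}|.
pose f (s : 'I_M.+1) := (w (b + s.*2), w (b + s.*2).+1).
have /fintype.injectivePn[s [s' ss' fss']] : ~~ injectiveb f.
  by apply/injectiveP => /leq_card; rewrite card_ord -/M ltnn.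
have lt (r r' : 'I_M.+1) : (r < r')%N -> f r = f r' ->
    exists i j, [/\ (b <= i)%N, (i.+1 < j)%N, (j <= b + M.*2)%N,
    w i = w j & w i.+1 = w j.+1].
  move=> rr' [e e1]; exists (b + r.*2)%N, (b + r'.*2)%N.
  by split=> //; have := ltn_ord r'; lia.
move: ss'; rewrite -val_eqE /= neq_ltn => /orP[/lt|/lt]; exact.
Qed.

Lemma spiral_of_window (D : finType) (E : D -> D -> Prop) (d d' : D) :
    window E #|{: D * D}|.*2 d d' ->
  exists (N : spiral) (h : spiral_structure N -> D),
    [/\ forall u v, fs_rel u v -> E (h u) (h v), coherent h &
        exists u v, [/\ fs_rel u v, h u = d & h v = d']].
Proof.
set K := _.*2 => -[w wE [wd wd']].
have [i [j [_ ij jK wij wij1]]] := repeated_pair w 0.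
have [k [l [Kk kl lK wkl wkl1]]] := repeated_pair w K.
have jk : (j < k.+1)%N by apply: leq_trans Kk; rewrite add0n in jK.
have wl : walk E l.+1 w.
  by move=> t tl; apply: wE; apply: leq_trans tl _; rewrite ltnS -addnn.
have [N [h [hE hcoh hw]]] := spiral_of_walk ij jk kl wij wij1 wkl wkl1 wl.
exists N, h; split=> //.
have [|u [v [uv hu hv]]] := hw K.
  by rewrite -/K in jK Kk *; lia.
by exists u, v; rewrite hu hv.
Qed.

Section components.
Variables (k : nat) (S : 'I_k -> spiral).

Definition component i (u : spiral_structure (S i)) : spiral_union S :=
  Tagged (fun c => 'I_(spiral_size (S c))) u.

Lemma component_surj (c : spiral_union S) :
  exists i (u : spiral_structure (S i)), c = component u.
Proof. by case: c => i u; exists i, u. Qed.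

Lemma component_relE i (u v : spiral_structure (S i)) :
  fs_rel (component u) (component v) = fs_rel u v.
Proof. by rewrite {1}/fs_rel/= eqxx tagged_asE. Qed.

Lemma component_succ i (u : spiral_structure (S i)) (c : spiral_union S) :
  fs_rel (component u) c ->
  exists2 v : spiral_structure (S i), c = component v & fs_rel u v.
Proof.
case: c => i' v /andP[/= /eqP ii']; case: _ / ii' in v *.
by rewrite tagged_asE; exists v.
Qed.

Lemma component_pred i (u : spiral_structure (S i)) (c : spiral_union S) :
  fs_rel c (component u) ->
  exists2 v : spiral_structure (S i), c = component v & fs_rel v u.
Proof.
case: c => i' v /andP[/= /eqP ii']; case: _ / ii' in u *.
by rewrite tagged_asE; exists v.
Qed.

End components.

(** The disjoint union of one spiral for each pair of points, each one covering
its pair if the latter lies in the middle of a long walk. The bound on the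
length of the walks is the one for which the pigeonhole principle applies. *)
Lemma spiral_cover (D : finType) (E : D -> D -> Prop) :
    (exists d d', window E #|{: D * D}|.*2 d d') ->
  exists (C : fin_structure) (h : C -> D),
    [/\ spiral_structures C, forall c c', fs_rel c c' -> E (h c) (h c'),
        coherent h &
        forall d d', window E #|{: D * D}|.*2 d d' ->
          exists c c', [/\ fs_rel c c', h c = d & h c' = d']].
Proof.
set K := _.*2 => -[d0 [d0' win0]].
(* Pairs that are not to be covered reuse the spiral of a fixed walk. *)
have /choice[S] (e : D * D) : exists S : {N : spiral & spiral_structure N -> D},
    [/\ forall u v, fs_rel u v -> E (tagged S u) (tagged S v),
        coherent (tagged S) &
        window E K e.1 e.2 ->
        exists u v, [/\ fs_rel u v, tagged S u = e.1 & tagged S v = e.2]].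
  have [/spiral_of_window[N [h [hE hcoh hw]]]|nwin] :=
    pselect (window E K e.1 e.2); first by exists (existT _ N h).
  have [N [h [hE hcoh _]]] := spiral_of_window win0.
  by exists (existT _ N h).
move=> SP; pose S' (i : 'I_#|{: D * D}|) := S (enum_val i).
pose C := spiral_union (fun i => tag (S' i)).
pose h (c : C) : D := tagged (S' (tag c)) (tagged c).
exists C, h; split.
- exists #|{: D * D}|, (fun i => tag (S' i)); split.
    by apply/card_gt0P; exists (d0, d0').
  exists id; exact: isomorphism_id.
- move=> c c'; have [i [u ->]] := component_surj c.
  move=> cc'; have [v -> uv] := component_succ cc'.
  by have [hE _ _] := SP (enum_val i); exact (hE u v uv).
- split=> c c1 c2; have [i [u ->]] := component_surj c.
    move=> cc1 cc2; have [v -> uv] := component_succ cc1.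
    have [v' -> uv'] := component_succ cc2.
    by have [_ [hS _] _] := SP (enum_val i); exact (hS u v v' uv uv').
  move=> cc1 cc2; have [v -> uv] := component_pred cc1.
  have [v' -> uv'] := component_pred cc2.
  by have [_ [_ hP] _] := SP (enum_val i); exact (hP u v v' uv uv').
- move=> d d' win.
  have [_ _] := SP (d, d'); move=> /(_ win) /=.
  rewrite -[(d, d')]enum_rankK -/(S' _) => -[u [v [uv hu hv]]].
  pose inj := @component _ (fun i => tag (S' i)) (enum_rank (d, d')).
  exists (inj u), (inj v); split=> //.
  exact: etrans (component_relE _ _) uv.
Qed.

(** The points are divided into [low] ones, closed under and deterministic for
going backward, and the others, closed under and deterministic for going
forward. *)
Definition splits_determinism (A : fin_structure) (low : pred A) :=
  [/\ forall a b : A, fs_rel a b -> low b -> low a,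
      forall a a' b : A, fs_rel a b -> fs_rel a' b -> low b -> a = a' &
      forall a b b' : A, fs_rel a b -> fs_rel a b' -> ~~ low a -> b = b'].

Lemma spiral_extendable N : extendable (@fs_rel (spiral_structure N)).
Proof.
case: N => n x y xyP; case: (xyP) => x0 xy yn u; split.
  have [un|un] := boolP (u == n.-1 :> nat).
    by exists y; rewrite /fs_rel/= /spiral_rel /= un eqxx !orbT.
  have un1 : (u.+1 < n)%N by have := ltn_ord u; rewrite /= in u un *; lia.
  by exists (Ordinal un1); rewrite /fs_rel /= /spiral_rel /= eqxx.
have [u0|u0] := boolP (u == 0 :> nat).
  by exists x; rewrite /fs_rel/= /spiral_rel /= u0 eqxx !orbT.
have un1 : (u.-1 < n)%N by have := ltn_ord u; rewrite /= in u u0 *; lia.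
exists (Ordinal un1); rewrite /fs_rel /= /spiral_rel /=; apply/or3P/Or31/eqP.
by rewrite prednK // lt0n.
Qed.

(** The low points are those of the first cycle: the distinguished point that
ends it is the only one with two successors, and the only point with two
predecessors lies beyond it. *)
Lemma spiral_splits_determinism N :
  @splits_determinism (spiral_structure N) (fun u => u <= spiral_x N)%N.
Proof.
case: N => n x y xyP; case: (xyP) => /= x0 xy yn; rewrite /fs_rel /=.
have relE (u v : 'I_n) : spiral_rel (N := Spiral xyP) u v ->
    v = u.+1 :> nat \/ (u = x :> nat /\ v = 0 :> nat) \/
    (u = n.-1 :> nat /\ v = y :> nat).
  case/or3P => [/eqP ?|/andP[/eqP-> /eqP ?]|/andP[/eqP ? /eqP->]]; by tauto.
split=> /=.
- by move=> a b /relE; lia.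
- by move=> a a' b /relE ab /relE a'b bx; apply/val_inj => /=; lia.
- move=> a b b' /relE ab /relE ab' ax; apply/val_inj => /=.
  by have := ltn_ord b; have := ltn_ord b'; lia.
Qed.

Lemma spiral_structures_dynamics (A : fin_structure) : spiral_structures A ->
  [/\ exists a : A, True, extendable (@fs_rel A) &
      exists low, @splits_determinism A low].
Proof.
move=> [k [S [k0 [phi [[_ surj relP] phi_bij]]]]].
have phiE (a a' : A) : fs_rel a a' <-> @fs_rel (spiral_union S) (phi a) (phi a').
  split=> [aa'|aa']; first by apply/(relP (phi a) (phi a')); exists a, a'.
  have /(relP (phi a) (phi a'))[b [b' [/(bij_inj phi_bij)-> /(bij_inj phi_bij)->]]] := aa'.
  by [].
split.
- have x := spiral_x (S (Ordinal k0)).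
  by have [a _] := surj (component x); exists a.
- move=> a; have [i [u E]] := component_surj (phi a).
  have [[v uv] [v' v'u]] := spiral_extendable u; split.
    have [b bE] := surj (component v).
    by exists b; apply/phiE; rewrite bE E component_relE.
  have [b bE] := surj (component v').
  by exists b; apply/phiE; rewrite bE E component_relE.
- exists (fun a => (tagged (phi a) <= spiral_x (S (tag (phi a))))%N); split.
  + move=> a b /phiE; have [i [u ->]] := component_surj (phi a).
    move=> /component_succ[v -> uv] /=.
    by have [+ _ _] := spiral_splits_determinism (S i); apply; exact: uv.
  + move=> a a' b /phiE + /phiE + Pb; move: Pb.
    have [i [u Eb]] := component_surj (phi b); rewrite Eb /= => ux.
    move=> /component_pred[v Ea vu] /component_pred[v' Ea' v'u].
    apply/(bij_inj phi_bij).
    have [_ + _] := spiral_splits_determinism (S i).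
    by rewrite Ea Ea' => /(_ _ _ _ vu v'u ux) ->.
  + move=> a b b' /phiE + /phiE + Pa; move: Pa.
    have [i [u Ea]] := component_surj (phi a); rewrite Ea /= => ux.
    move=> /component_succ[v Eb vu] /component_succ[v' Eb' v'u].
    apply/(bij_inj phi_bij).
    have [_ _ +] := spiral_splits_determinism (S i).
    by rewrite Eb Eb' => /(_ _ _ _ vu v'u ux) ->.
Qed.

Section lifting.
Variables (A B : fin_structure) (phi : B -> A) (low : pred A).
Hypothesis epi : @epimorphism B A phi.
Hypothesis extB : extendable (@fs_rel B).
Hypothesis lowP : splits_determinism low.

Let lifts m (a : nat -> A) (b : nat -> B) :=
  walk (@fs_rel B) m b /\ forall t, (t <= m)%N -> phi (b t) = a t.

Let lifts_cons m (a : nat -> A) (b : nat -> B) b0 :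
  lifts m (fun t => a t.+1) b -> fs_rel b0 (b 0) -> phi b0 = a 0 ->
  lifts m.+1 a (fun t => if t is t'.+1 then b t' else b0).
Proof.
by move=> [bw ba] b0b b0a; split=> -[|t]//; [exact: bw|exact: ba].
Qed.

(** Among non-low points a lift can be constructed from its starting point, as
the walk has no choice. *)
Let lift_high m (a : nat -> A) (b0 : B) :
  walk (@fs_rel A) m a -> ~~ low (a 0) -> phi b0 = a 0 ->
  exists2 b, lifts m a b & b 0 = b0.
Proof.
have [hom _ _] := (fin_epimorphismP _).1 epi.
have [lowd _ detS] := lowP.
elim: m a b0 => [|m IHm] a b0 aw a0 b0a.
  by exists (fun=> b0) => //; split=> // -[].
have [[b1 b01] _] := extB b0.
have b1a : phi b1 = a 1.
  by apply: detS a0; [rewrite -b0a; exact: hom|exact: (aw 0)].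
have [|||b bl b1E] := IHm (fun t => a t.+1) b1.
- by move=> t tm; exact: (aw t.+1).
- by apply: contra a0; apply: lowd; exact: aw.
- exact: b1a.
by eexists; [apply: (lifts_cons (b0 := b0)) bl _ _; rewrite ?b1E|].
Qed.

(** By induction on the length, adding a first edge. If this edge ends in a low
point, any predecessor of the lift already found lies over the right point. If
it starts in a low point and ends in a non-low one, the edge itself is lifted,
and the rest of the walk is lifted forward from there. *)
Lemma walk_lifting m (a : nat -> A) : walk (@fs_rel A) m a ->
  exists2 b, walk (@fs_rel B) m b & forall t, (t <= m)%N -> phi (b t) = a t.
Proof.
suff: walk (@fs_rel A) m a -> exists b, lifts m a b.
  by move=> H /H[b []]; exists b.
have [hom surj rel] := (fin_epimorphismP _).1 epi.
have [lowd detP _] := lowP.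
elim: m a => [|m IHm] a aw.
  by have [b ba] := surj (a 0); exists (fun=> b); split=> // -[].
have a01 : fs_rel (a 0) (a 1) by exact: aw.
have aw' : walk (@fs_rel A) m (fun t => a t.+1) by move=> t; exact: (aw t.+1).
have [a1|a1] := boolP (low (a 1)).
  have [b bl] := IHm _ aw'.
  have [_ [b0 b01]] := extB (b 0).
  eexists; apply: (lifts_cons bl b01 _).
  apply: detP a1; last exact: a01.
  by rewrite -bl.2//; exact: hom.
have [b0 [b1 [b0a b1a b01]]] := rel _ _ a01.
have [b bl b1E] := lift_high aw' a1 b1a.
by eexists; apply: lifts_cons bl _ b0a; rewrite b1E.
Qed.

End lifting.

(** The graph to be covered is the part of the product where [P] holds. Its
edges need not all lie in the middle of long walks, but enough of them do:
every edge of either structure extends to a long walk there, which has a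
partner in the other structure. *)
Lemma spiral_joint_cover (B1 B2 : fin_structure) (P : B1 -> B2 -> Prop) :
    spiral_structures B1 -> spiral_structures B2 ->
    (forall m a, walk (@fs_rel B1) m a -> exists2 b, walk (@fs_rel B2) m b &
      forall t, (t <= m)%N -> P (a t) (b t)) ->
    (forall m b, walk (@fs_rel B2) m b -> exists2 a, walk (@fs_rel B1) m a &
      forall t, (t <= m)%N -> P (a t) (b t)) ->
  exists (C : fin_structure) (phi1 : C -> B1) (phi2 : C -> B2),
    [/\ spiral_structures C, @epimorphism C B1 phi1, @epimorphism C B2 phi2 &
        forall c, P (phi1 c) (phi2 c)].
Proof.
move=> /spiral_structures_dynamics[[b1 _] ext1 _].
move=> /spiral_structures_dynamics[_ ext2 _] lift12 lift21.
pose E (u v : B1 * B2) :=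
  [/\ fs_rel u.1 v.1, fs_rel u.2 v.2, P u.1 u.2 & P v.1 v.2].
set K := #|{: (B1 * B2) * (B1 * B2)}|.*2.
have win m (a : nat -> B1) (b : nat -> B2) : walk (@fs_rel B1) m.*2.+1 a ->
    walk (@fs_rel B2) m.*2.+1 b ->
    (forall t, (t <= m.*2.+1)%N -> P (a t) (b t)) ->
    window E m (a m, b m) (a m.+1, b m.+1).
  move=> aw bw ab; exists (fun t => (a t, b t)) => // t tm.
  by split=> /=; [exact: aw|exact: bw|apply: ab; exact: ltnW|exact: ab].
have win1 (d d' : B1) : fs_rel d d' -> exists e e', window E K (d, e) (d', e').
  move=> /(extendable_window K ext1)[a aw [<- <-]].
  by have [b bw ab] := lift12 _ _ aw; exists (b K), (b K.+1); exact: win.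
have win2 (d d' : B2) : fs_rel d d' -> exists e e', window E K (e, d) (e', d').
  move=> /(extendable_window K ext2)[a aw [<- <-]].
  by have [b bw ab] := lift21 _ _ aw; exists (b K), (b K.+1); exact: win.
have [[b1' /win1[e [e' w0]]] _] := ext1 b1.
have [|C [h [spC hE _ hw]]] := @spiral_cover (B1 * B2)%type E.
  by do 2 eexists; exact: w0.
have [_ extC _] := spiral_structures_dynamics spC.
exists C, (fst \o h), (snd \o h); split=> //.
- have rel a a' : fs_rel a a' ->
      exists b b', [/\ (h b).1 = a, (h b').1 = a' & fs_rel b b'].
    by move=> /win1[d [d' /hw[c [c' [cc' hc hc']]]]]; exists c, c'; rewrite hc hc'.
  apply/fin_epimorphismP; split=> //= [c c' /hE[]//|a].
  by have [[a' /rel[c [c' [ca _ _]]]] _] := ext1 a; exists c.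
- have rel a a' : fs_rel a a' ->
      exists b b', [/\ (h b).2 = a, (h b').2 = a' & fs_rel b b'].
    by move=> /win2[d [d' /hw[c [c' [cc' hc hc']]]]]; exists c, c'; rewrite hc hc'.
  apply/fin_epimorphismP; split=> //= [c c' /hE[]//|a].
  by have [[a' /rel[c [c' [ca _ _]]]] _] := ext2 a; exists c.
- by move=> c; have [[c' /hE[]]] := extC c.
Qed.

Lemma spiral_joint_projection : joint_projection spiral_structures.
Proof.
move=> A B spA spB.
have [[a _] extA _] := spiral_structures_dynamics spA.
have [[b _] extB _] := spiral_structures_dynamics spB.
have [||C [phi [psi [spC epiA epiB _]]]] :=
    @spiral_joint_cover A B (fun _ _ => True) spA spB.
- by move=> m _ _; have [w ww _] := extendable_walk m b extB; exists w.
- by move=> m _ _; have [w ww _] := extendable_walk m a extA; exists w.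
by exists C; split=> //; split; [exists phi|exists psi].
Qed.

Lemma spiral_amalgamation : proj_amalgamation spiral_structures.
Proof.
move=> A B1 B2 phi1 phi2 spA spB1 spB2 epi1 epi2.
have [_ _ [low lowP]] := spiral_structures_dynamics spA.
have [_ ext1 _] := spiral_structures_dynamics spB1.
have [_ ext2 _] := spiral_structures_dynamics spB2.
have map_walk (B : fin_structure) (phi : B -> A) m b : @epimorphism B A phi ->
    walk (@fs_rel B) m b -> walk (@fs_rel A) m (phi \o b).
  by move=> /fin_epimorphismP[hom _ _] bw t tm; apply: hom; exact: bw.
have [||C [phi3 [phi4 [spC epi3 epi4 comm]]]] :=
    @spiral_joint_cover B1 B2 (fun b1 b2 => phi1 b1 = phi2 b2) spB1 spB2.
- move=> m a /(map_walk _ _ _ _ epi1)/(walk_lifting epi2 ext2 lowP)[b bw ba].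
  by exists b => // t /ba->.
- move=> m a /(map_walk _ _ _ _ epi2)/(walk_lifting epi1 ext1 lowP)[b bw ba].
  by exists b => // t /ba->.
by exists C, phi3, phi4; split=> //; apply/funext => c; exact: comm.
Qed.

(** Obtained by covering two disjoint copies of [A]. *)
Lemma spiral_splitting (A : fin_structure) : spiral_structures A ->
  exists (B : fin_structure) (psi : B -> A) (s : B -> bool),
    [/\ spiral_structures B, @epimorphism B A psi, coherent psi &
        forall a e, exists b, psi b = a /\ s b = e].
Proof.
move=> /spiral_structures_dynamics[[a0 _] extA _].
pose E (u v : A * bool) := fs_rel u.1 v.1 /\ u.2 = v.2.
have extE : extendable E.
  move=> [a e]; have [[a' aa'] [a'' a''a]] := extA a.
  by split; [exists (a', e)|exists (a'', e)].
have [|B [h [spB hE hcoh hw]]] := @spiral_cover (A * bool)%type E.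
  have [[d' dd'] _] := extE (a0, true).
  by exists (a0, true), d'; exact: extendable_window.
have rel a a' e : fs_rel a a' ->
    exists b b', [/\ h b = (a, e), h b' = (a', e) & fs_rel b b'].
  move=> aa'; have [|b [b' [bb' hb hb']]] := hw (a, e) (a', e).
    exact: extendable_window.
  by exists b, b'.
have surj a e : exists b, h b = (a, e).
  by have [[a' /(rel _ _ e)[b [_ [hb _ _]]]] _] := extA a; exists b.
exists B, (fst \o h), (snd \o h); split=> //.
- apply/fin_epimorphismP; split=> /= [b b' /hE[]//|a|a a' /(rel _ _ true)].
    by have [b hb] := surj a true; exists b; rewrite hb.
  by move=> [b [b' [hb hb' bb']]]; exists b, b'; rewrite hb hb'.
- by split=> c c1 c2 /=; [move=> /hcoh.1 H /H ->|move=> /hcoh.2 H /H ->].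
- by move=> a e; have [b hb] := surj a e; exists b; rewrite /= hb.
Qed.

(** * Locally constant maps and compact zero-dimensional spaces *)

(** This is continuity for the discrete topology on [X], but it composes with
arbitrary maps between arbitrary types. *)
Definition locally_constant (T : topologicalType) (X : Type) (f : T -> X) :=
  forall x, nbhs x [set y | f y = f x].

Section locally_constant.
Variable T : topologicalType.

Lemma locally_constant_comp (X Y : Type) (f : T -> X) (h : X -> Y) :
  locally_constant f -> locally_constant (h \o f).
Proof. by move=> fc x; apply: filterS (fc x) => y /= ->. Qed.

Lemma locally_constant_pair (X Y : Type) (f : T -> X) (g : T -> Y) :
  locally_constant f -> locally_constant g ->
  locally_constant (fun x => (f x, g x)).
Proof. by move=> fc gc x; apply: filterS2 (fc x) (gc x) => y /= -> ->. Qed.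

Lemma locally_constant_precomp (S : topologicalType) (X : Type) (f : T -> X)
    (g : S -> T) :
  locally_constant f -> continuous g -> locally_constant (f \o g).
Proof. by move=> fc gc x; exact: gc x _ (fc (g x)). Qed.

Lemma locally_constant_open (X : Type) (f : T -> X) (A : set X) :
  locally_constant f -> open (f @^-1` A).
Proof.
move=> fc; rewrite openE => x /= Afx.
by apply: filterS (fc x) => y /= ->.
Qed.

Lemma locally_constant_closed (X : Type) (f : T -> X) (A : set X) :
  locally_constant f -> closed (f @^-1` A).
Proof. by move=> fc; rewrite -openC; exact: locally_constant_open (~` A) fc. Qed.

Lemma clopen_locally_constant (A : set T) :
  clopen A -> locally_constant (fun x => `[< A x >]).
Proof.
move=> [Ao /closed_openC Ac] x; have [Ax|nAx] := pselect (A x).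
  apply: filterS (open_nbhs_nbhs (conj Ao Ax)) => y /= Ay.
  by rewrite !asboolT.
by apply: filterS (open_nbhs_nbhs (conj Ac nAx)) => y /= nAy; rewrite !asboolF.
Qed.

Lemma continuous_locally_constant (X : choiceType)
  (f : T -> discrete_topology X) : continuous f <-> locally_constant f.
Proof.
split=> [fc x|fc x U fxU].
  have fx : nbhs (f x) [set f x] by exact: discrete_set1.
  exact: fc fx.
have fU : [set y | f y = f x] `<=` f @^-1` U.
  by move=> y /= ->; exact: (nbhs_singleton fxU).
exact: filterS fU (fc x).
Qed.

End locally_constant.

Lemma fiber_product_closed (T S : topologicalType) (X : Type) (f : T -> X)
    (g : S -> X) : locally_constant f -> locally_constant g ->
  closed [set p : T * S | f p.1 = g p.2].
Proof.
move=> fc gc.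
have fgc : locally_constant (fun p : T * S => (f p.1, g p.2)).
  apply: locally_constant_pair.
    by apply: (locally_constant_precomp fc) => p; exact: cvg_fst.
  by apply: (locally_constant_precomp gc) => p; exact: cvg_snd.
exact (@locally_constant_closed _ _ _ [set q : X * X | q.1 = q.2] fgc).
Qed.

Definition separating (T : topologicalType) (e : nat -> T -> bool) :=
  (forall n, locally_constant (e n)) /\
  forall x y, (forall n, e n x = e n y) -> x = y.

(** For each pair of basic open sets that some clopen set separates, one such
clopen set is chosen. *)
Lemma separating_exists (T : topologicalType) :
  zero_dimensional T -> @second_countable T -> exists e, @separating T e.
Proof.
move=> zdT [B /countable_injP[k kinj] [Bo Bb]].
have /choice[c cP] (p : nat * nat) : exists c : T -> bool, locally_constant c /\
    forall U V, B U -> B V -> k U = p.1 -> k V = p.2 ->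
    (exists C, [/\ clopen C, U `<=` C & V `<=` ~` C]) ->
    forall u v, U u -> V v -> c u != c v.
  have [[U [V [BU BV kU kV [C [Ccl UC VC]]]]]|no] := pselect (exists U V,
      [/\ B U, B V, k U = p.1, k V = p.2 &
      exists C, [/\ clopen C, U `<=` C & V `<=` ~` C]]).
    exists (fun x => `[< C x >]); split; first exact: clopen_locally_constant.
    move=> U' V' BU' BV' kU' kV' _ u v U'u V'v.
    have UU' : U' = U by apply: kinj; rewrite ?inE// kU'.
    have VV' : V' = V by apply: kinj; rewrite ?inE// kV'.
    rewrite asboolT; last by apply: UC; rewrite -UU'.
    by rewrite asboolF//; apply: VC; rewrite -VV'.
  exists (fun=> true); split=> [x|U V BU BV kU kV UV].
    exact: filterS (@filterT _ (nbhs x) _).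
  by exfalso; apply: no; exists U, V.
exists (fun n => if unpickle n is Some p then c p else fun=> true); split.
  move=> n x; case: unpickle => [p|]; first exact: (cP p).1.
  exact: filterS (@filterT _ (nbhs x) _).
move=> x y exy; apply/eqP/negP => /negP xy.
have [C [Ccl Cx nCy]] := zdT _ _ xy.
have Cx' : nbhs x C by apply: open_nbhs_nbhs; split=> //; exact: Ccl.1.
have Cy' : nbhs y (~` C).
  by apply: open_nbhs_nbhs; split=> //; exact: closed_openC Ccl.2.
have [U [BU Ux] UC] := Bb x _ Cx'; have [V [BV Vy] VC] := Bb y _ Cy'.
have := exy (pickle (k U, k V)); rewrite pickleK => /eqP; apply/negP.
by apply: (cP (k U, k V)).2 Ux Vy => //; exists C.
Qed.

(** The first [n] terms of a separating sequence; by compactness these maps are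
cofinal among locally constant maps. *)
Definition prefix_code (T : Type) (e : nat -> T -> bool) n (x : T) :
  {ffun 'I_n -> bool} := [ffun i : 'I_n => e i x].

Lemma locally_constant_prefix_code (T : topologicalType) (e : nat -> T -> bool)
  n : separating e -> locally_constant (prefix_code e n).
Proof.
move=> [ec _] x.
have : \forall y \near x, forall i : 'I_n, e i y = e i x.
  apply: filter_forall => i; exact: ec.
by apply: filterS => y exy; apply/ffunP => i; rewrite !ffunE.
Qed.

Lemma nested_compact (T : topologicalType) (K : nat -> set T) (U : set T) :
    compact [set: T] -> (forall n, closed (K n)) ->
    (forall n, K n.+1 `<=` K n) -> open U -> \bigcap_n K n `<=` U ->
  exists n, K n `<=` U.
Proof.
move=> cT Kc Kd Uo KU.
have Kmono m n : (m <= n)%N -> K n `<=` K m.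
  move=> /subnK<-; elim: (n - m)%N => [//|d IHd] x /=.
  by rewrite addSn => /Kd/IHd.
have /(_ nat \oo (fun n x => K n x -> U x) _)[|n _ nP] :=
    (compact_near_coveringP _).1 cT.
  move=> x _; have [Ux|nUx] := pselect (U x).
    exists (U, setT) => /=; last by move=> [y n] /= [].
    by split; [exact: open_nbhs_nbhs|exact: filterT].
  have [n nKx] : exists n, ~ K n x.
    by apply/existsNP => Kx; apply: nUx; apply: KU => n _; exact: Kx.
  exists (~` K n, [set m | (n <= m)%N]) => /=.
    split; last by exists n.
    by apply: open_nbhs_nbhs; split=> //; exact: closed_openC.
  by move=> [y m] /= [nKy nm] /(Kmono _ _ nm).
by exists n => x; apply: (nP n) => /=.
Qed.

Lemma separating_cofinal (T : topologicalType) (e : nat -> T -> bool)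
    (U : set (T * T)) :
    compact [set: T] -> separating e -> open U -> (forall x, U (x, x)) ->
  exists n, forall x y, prefix_code e n x = prefix_code e n y -> U (x, y).
Proof.
move=> cT esep Uo Ud.
pose K n := [set p : T * T | prefix_code e n p.1 = prefix_code e n p.2].
have cTT : compact [set: T * T] by rewrite -setXTT; exact: compact_setX.
have [|||n nP] := @nested_compact _ K U cTT _ _ Uo.
- by move=> n; apply: fiber_product_closed; exact: locally_constant_prefix_code.
- move=> n [x y] /= xy; apply/ffunP => i; rewrite !ffunE.
  by have := congr1 (fun f : {ffun _ -> _} => f (widen_ord (leqnSn n) i)) xy;
    rewrite !ffunE.
- move=> [x y] Kxy; suff -> : x = y by exact: Ud.
  apply: esep.2 => n; have /= xy := Kxy n.+1 I.
  by have := congr1 (fun f : {ffun _ -> _} => f (inord n)) xy;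
    rewrite !ffunE inordK.
by exists n => x y xy; apply: (nP (x, y)).
Qed.

Lemma locally_constant_factor (T : topologicalType) (e : nat -> T -> bool)
    (X : Type) (f : T -> X) :
    compact [set: T] -> separating e -> locally_constant f ->
  exists n, forall x y, prefix_code e n x = prefix_code e n y -> f x = f y.
Proof.
move=> cT esep fc.
apply: (separating_cofinal (U := [set p | f p.1 = f p.2]) cT esep) => //.
rewrite openE => -[x y] /= fxy.
exists ([set z | f z = f x], [set z | f z = f y]); first by split; exact: fc.
by move=> [z t] /= [-> ->].
Qed.

(** The preimage of a closed set is the projection of a compact part of the
graph. *)
Lemma closed_graph_continuous (T S : topologicalType) (f : T -> S) :
    compact [set: T] -> compact [set: S] -> hausdorff_space T ->
    closed [set p : T * S | p.2 = f p.1] ->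
  continuous f.
Proof.
move=> cT cS hT fc; apply/continuous_closedP => C Cc.
have -> : f @^-1` C = fst @` ([set p : T * S | p.2 = f p.1] `&` snd @^-1` C).
  apply/seteqP; split=> [x Cfx|_ [[x y] /= [-> Cfx] <-]] //.
  by exists (x, f x).
apply: compact_closed => //; apply: continuous_compact.
  by apply: continuous_subspaceT => p; exact: cvg_fst.
have cTS : compact [set: T * S] by rewrite -setXTT; exact: compact_setX.
apply: (subclosed_compact _ cTS) => //; apply: closedI => //.
by apply: preimage_closed => // p _; exact: cvg_snd.
Qed.

Lemma closed_bijection_homeomorphism (T S : topologicalType)
    (R : set (T * S)) :
    compact [set: T] -> compact [set: S] ->
    hausdorff_space T -> hausdorff_space S -> closed R ->
    (forall t, exists s, R (t, s)) -> (forall s, exists t, R (t, s)) ->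
    (forall t s s', R (t, s) -> R (t, s') -> s = s') ->
    (forall t t' s, R (t, s) -> R (t', s) -> t = t') ->
  exists2 f : T -> S, homeomorphism f & R = [set p | p.2 = f p.1].
Proof.
move=> cT cS hT hS Rc /choice[f fR] /choice[g gR] Rfun Rinj.
have RE : R = [set p | p.2 = f p.1].
  apply/seteqP; split=> [[t s]|[t s] /= ->]; last exact: fR.
  by move=> /= ts; apply: Rfun ts _.
have RE' : (fun p => (p.2, p.1)) @^-1` R = [set p : S * T | p.2 = g p.1].
  apply/seteqP; split=> [[s t]|[s t] /= ->]; last exact: gR.
  by move=> /= ts; apply: Rinj ts _.
exists f => //; split.
  by apply: closed_graph_continuous => //; rewrite -RE.
exists g; split.
- apply: closed_graph_continuous => //; rewrite -RE'.
  apply: preimage_closed => // p _.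
  by apply: cvg_pair; [exact: cvg_snd|exact: cvg_fst].
- by move=> t; apply: (Rinj _ _ (f t)).
- by move=> s; apply: (Rfun (g s)).
Qed.

(** A member of [M] is a finite approximation of the graph of the map to be
constructed. The graph is the intersection of a decreasing sequence of members
of [M] that separate more and more points on both sides. By compactness its
sections are nonempty, and contain a pair related by [F] and [G] over each pair
[(t, F t)]; separation makes it single-valued. *)
Lemma back_and_forth (T S : topologicalType) (F : T -> T) (G : S -> S)
    (eT : nat -> T -> bool) (eS : nat -> S -> bool)
    (M : set (set (T * S))) (Q0 : set (T * S)) :
    compact [set: T] -> compact [set: S] ->
    hausdorff_space T -> hausdorff_space S ->
    continuous F -> continuous G -> separating eT -> separating eS ->
    (forall Q, M Q -> closed Q) ->
    (forall Q, M Q -> forall t, exists s, Q (t, s) /\ Q (F t, G s)) ->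
    (forall Q, M Q -> forall s, exists t, Q (t, s)) ->
    (forall Q (e : T -> bool), M Q -> locally_constant e ->
      exists2 Q', M Q' & Q' `<=` Q /\
        forall t t' s, Q' (t, s) -> Q' (t', s) -> e t = e t') ->
    (forall Q (e : S -> bool), M Q -> locally_constant e ->
      exists2 Q', M Q' & Q' `<=` Q /\
        forall t s s', Q' (t, s) -> Q' (t, s') -> e s = e s') ->
    M Q0 ->
  exists g : T -> S,
    [/\ homeomorphism g, forall t, g (F t) = G (g t) & forall t, Q0 (t, g t)].
Proof.
move=> cT cS hT hS Fc Gc eTs eSs Mc MT MS extT extS MQ0.
have /choice[next nextP] (nQ : nat * {Q | M Q}) : exists Q' : {Q | M Q},
    [/\ sval Q' `<=` sval nQ.2,
        forall t t' s, sval Q' (t, s) -> sval Q' (t', s) ->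
          eT nQ.1 t = eT nQ.1 t' &
        forall t s s', sval Q' (t, s) -> sval Q' (t, s') ->
          eS nQ.1 s = eS nQ.1 s'].
  case: nQ => n [Q MQ] /=.
  have [Q' MQ' [Q'Q Q'e]] := extT _ _ MQ (eTs.1 n).
  have [Q'' MQ'' [Q''Q' Q''e]] := extS _ _ MQ' (eSs.1 n).
  exists (exist _ Q'' MQ'') => /=; split=> //.
  - exact: subset_trans Q''Q' Q'Q.
  - by move=> t t' s /Q''Q' + /Q''Q'; exact: Q'e.
pose chain := fix chain n : {Q | M Q} :=
  if n is m.+1 then next (m, chain m) else exist _ Q0 MQ0.
pose Q n := sval (chain n).
have MQ n : M (Q n) by rewrite /Q; case: (chain n).
have Qd n : Q n.+1 `<=` Q n by have [] := nextP (n, chain n).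
have QT n t t' s : Q n.+1 (t, s) -> Q n.+1 (t', s) -> eT n t = eT n t'.
  by have [_ + _] := nextP (n, chain n); exact.
have QS n t s s' : Q n.+1 (t, s) -> Q n.+1 (t, s') -> eS n s = eS n s'.
  by have [_ _ +] := nextP (n, chain n); exact.
pose R := \bigcap_n Q n.
have nonempty (U : topologicalType) (K : nat -> set U) : compact [set: U] ->
    (forall n, closed (K n)) -> (forall n, K n.+1 `<=` K n) ->
    (forall n, exists x, K n x) -> exists x, forall n, K n x.
  move=> cU Kc Kd Kne; apply/not_existsP => none.
  have [|n] := nested_compact cU Kc Kd (@open0 U).
    by move=> x Kx; apply: (none x) => n; exact: Kx.
  by have [x Kx] := Kne n => /(_ _ Kx).
have section_closed (t : T) n : closed [set s | Q n (t, s)].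
  have ct : continuous (fun s : S => (t, s)).
    by move=> s; apply: cvg_pair; [exact: cvg_cst|exact: cvg_id].
  exact: (continuous_closedP _).1 ct _ (Mc _ (MQ n)).
have RT t : exists s, R (t, s) /\ R (F t, G s).
  have [||||s sP] := @nonempty S (fun n => [set s | Q n (t, s) /\ Q n (F t, G s)]).
  - exact: cS.
  - move=> n; apply: (@closedI _ [set s | Q n (t, s)]
                        (G @^-1` [set s | Q n (F t, s)])) => //.
    exact: (continuous_closedP G).1 Gc _ (section_closed (F t) n).
  - by move=> n s [? ?]; split; exact: Qd.
  - by move=> n; exact: MT.
  by exists s; split=> n _; have [] := sP n.
have RS s : exists t, R (t, s).
  have [||||t tP] := @nonempty T (fun n => [set t | Q n (t, s)]).
  - exact: cT.
  - move=> n; have ct : continuous (fun t : T => (t, s)).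
      by move=> t; apply: cvg_pair; [exact: cvg_id|exact: cvg_cst].
    exact: (continuous_closedP _).1 ct _ (Mc _ (MQ n)).
  - by move=> n t; exact: Qd.
  - by move=> n; exact: MS.
  by exists t => n _; exact: tP.
have Rfun t s s' : R (t, s) -> R (t, s') -> s = s'.
  by move=> ts ts'; apply: eSs.2 => n; apply: (QS n t); [exact: ts|exact: ts'].
have Rinj t t' s : R (t, s) -> R (t', s) -> t = t'.
  by move=> ts ts'; apply: eTs.2 => n; apply: (QT n _ _ s);
    [exact: ts|exact: ts'].
have [||g gh RE] := closed_bijection_homeomorphism cT cS hT hS _ _ RS Rfun Rinj.
- by apply: closed_bigI => n _; exact: Mc.
- by move=> t; have [s []] := RT t; exists s.
exists g; split=> // t.
- have [s [ts FtGs]] := RT t.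
  by move: ts FtGs; rewrite RE /= => <- <-.
- by have tg : R (t, g t); [rewrite RE|exact: (tg 0 I)].
Qed.

(** * Uniqueness of the Cantor set *)

(** A separating sequence stands for zero-dimensionality and second countability
together, which is how these are used. *)
Definition stone_space (T : topologicalType) :=
  [/\ compact [set: T], hausdorff_space T & exists e, @separating T e].

Definition no_isolated_point (T : topologicalType) := forall x : T, ~ open [set x].

Definition same_range (T S X : Type) (phi : T -> X) (psi : S -> X) :=
  (forall t, exists s, phi t = psi s) /\ (forall s, exists t, phi t = psi s).

Lemma same_range_sym (T S X : Type) (phi : T -> X) (psi : S -> X) :
  same_range phi psi -> same_range psi phi.
Proof.
move=> [ts st]; split=> [s|t]; first by have [t] := st s; exists t.
by have [s] := ts t; exists s.
Qed.

Lemma fiber_splitting (T : topologicalType) (X : Type) (f : T -> X) (x : T) :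
    stone_space T -> no_isolated_point T -> locally_constant f ->
  exists2 c : T -> bool, locally_constant c &
    forall b, exists2 y, f y = f x & c y = b.
Proof.
move=> [_ _ [e [ec esep]]] perfT fc.
have [y fy xy] : exists2 y, f y = f x & y <> x.
  apply: contrapT => /forall2NP none; apply: (perfT x).
  suff -> : [set x] = f @^-1` [set f x] by exact: locally_constant_open.
  apply/seteqP; split=> [_ ->|y /= fy] //=.
  by have [//|/contrapT] := none y.
have [n exy] : exists n, e n y != e n x.
  apply: contrapT => /forallNP none; apply: xy; apply: esep => n.
  by apply/eqP/negP => /negP; exact: none.
exists (e n) => // b; have [<-|nb] := eqVneq (e n x) b; first by exists x.
by exists y => //; move: exy nb; case: (e n y); case: (e n x); case: b.
Qed.

(** If [e] takes both values on a fibre of [phi], then the corresponding one of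
[psi], which is open and hence not a single point, is split in two; otherwise
[c] copies the single value of [e]. *)
Lemma same_range_refinement (T S : topologicalType) (X : Type) (phi : T -> X)
    (psi : S -> X) (e : T -> bool) :
    stone_space S -> no_isolated_point S -> locally_constant psi ->
    same_range phi psi ->
  exists2 c : S -> bool, locally_constant c &
    same_range (fun t => (phi t, e t)) (fun s => (psi s, c s)).
Proof.
move=> stS perfS psic [ts st].
have cst_lc (b : bool) : locally_constant (fun _ : S => b).
  by move=> s; exact: filterS (@filterT _ (nbhs s) _).
have /choice[c cP] (x : X) : exists c : S -> bool, locally_constant c /\
    forall b, (exists2 t, phi t = x & e t = b) <->
              (exists2 s, psi s = x & c s = b).
  have [[t tx]|nx] := pselect (exists t, phi t = x); last first.
    exists (fun=> true); split=> // b; split=> [[t tx]|[s sx _]].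
      by exfalso; apply: nx; exists t.
    by exfalso; apply: nx; have [t ts'] := st s; exists t; rewrite ts'.
  have [s sx] := ts t; rewrite tx in sx.
  have [both|one] := pselect (forall b, exists2 t, phi t = x & e t = b).
    have [c cc cb] := fiber_splitting s stS perfS psic.
    exists c; split=> // b; split=> _; last exact: both.
    by have [s' s's cs'] := cb b; exists s' => //; rewrite s's.
  exists (fun=> e t); split=> // b; split=> [[t' t'x <-]|[s' _ <-]].
    exists s => //; apply/eqP/negP => /negP ett'; apply: one => b'.
    have [<-|nb] := eqVneq (e t) b'; first by exists t.
    by exists t' => //; move: ett' nb; case: (e t); case: (e t'); case: b'.
  by exists t.
exists (fun s => c (psi s) s).
  move=> s; apply: filterS2 (psic s) ((cP (psi s)).1 s) => s' /= -> ->.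
  by [].
split=> [t|s].
  have [_ /(_ (e t))[+ _]] := cP (phi t).
  case; first by exists t.
  by move=> s sx cs; exists s; rewrite sx cs.
have [_ /(_ (c (psi s) s))[_]] := cP (psi s).
case; first by exists s.
by move=> t tx et; exists t; rewrite tx et.
Qed.

(** The approximations are given by locally constant maps with the same values,
and there is no dynamics to respect. Besides the uniqueness of the Cantor set
this gives homeomorphisms with a prescribed effect on a clopen partition. *)
Lemma perfect_stone_homeomorphism (T S : topologicalType) (X : Type)
    (phi : T -> X) (psi : S -> X) :
    stone_space T -> stone_space S ->
    no_isolated_point T -> no_isolated_point S ->
    locally_constant phi -> locally_constant psi -> same_range phi psi ->
  exists2 g : T -> S, homeomorphism g & forall t, phi t = psi (g t).
Proof.
move=> stT stS perfT perfS phic psic phipsi.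
have [cT hT [eT eTs]] := stT; have [cS hS [eS eSs]] := stS.
pose M (Q : set (T * S)) := exists Y (f : T -> Y) (g : S -> Y),
  [/\ locally_constant f, locally_constant g, same_range f g &
      Q = [set p | f p.1 = g p.2]].
have [||||||||g [gh _ gQ]] := @back_and_forth T S id id eT eS M
    [set p | phi p.1 = psi p.2] cT cS hT hS _ _ eTs eSs.
- by move=> t; exact: cvg_id.
- by move=> t; exact: cvg_id.
- by move=> Q [Y [f [g [fc gc _ ->]]]]; exact: fiber_product_closed.
- by move=> Q [Y [f [g [_ _ [fg _] ->]]]] t; have [s] := fg t; exists s.
- by move=> Q [Y [f [g [_ _ [_ gf] ->]]]] s; have [t] := gf s; exists t.
- move=> Q e [Y [f [g [fc gc fg ->]]]] ec.
  have [c cc fecg] := same_range_refinement e stS perfS gc fg.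
  exists [set p | (f p.1, e p.1) = (g p.2, c p.2)].
    exists (Y * bool)%type, (fun t => (f t, e t)), (fun s => (g s, c s)).
    by split=> //; exact: locally_constant_pair.
  split=> [[t s] /= [-> _]//|t t' s /= [_ ->] [_ ->]] //.
- move=> Q e [Y [f [g [fc gc fg ->]]]] ec.
  have [c cc fecg] :=
    same_range_refinement e stT perfT fc (same_range_sym fg).
  exists [set p | (f p.1, c p.1) = (g p.2, e p.2)].
    exists (Y * bool)%type, (fun t => (f t, c t)), (fun s => (g s, e s)).
    split=> //; [exact: locally_constant_pair|exact: locally_constant_pair|].
    exact: same_range_sym.
  split=> [[t s] /= [-> _]//|t s s' /= [_ <-] [_ <-]] //.
- by exists X, phi, psi.
by exists g => // t; exact: gQ.
Qed.

Definition coordinate (n : nat) (x : cantor_space) : bool := x n.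

Lemma cantor_stone_space : stone_space cantor_space.
Proof.
split; [exact: cantor_space_compact|exact: cantor_space_hausdorff|].
exists coordinate; split=> [n|x y exy]; last by apply/funext => n; exact: exy.
move=> x.
have ct : continuous (proj n : cantor_space -> bool) by exact: proj_continuous.
by apply: (ct x [set x n]); exact: discrete_set1.
Qed.

Lemma cantor_no_isolated_point : no_isolated_point cantor_space.
Proof. by move=> x; have /perfectTP := cantor_perfect; exact. Qed.

(** * The limit relation as the graph of a homeomorphism of the Cantor set *)

Section limit.
Variables (L : topologicalType) (R : set (L * L)).
Let LR := RStructure R.
Hypothesis lim : proj_fraisse_limit spiral_structures LR.

Lemma limit_stone_space : stone_space L.
Proof.
by have [[cL hL zL sL _] _ _ _] := lim; split=> //; exact: separating_exists.
Qed.

Lemma limit_resolution (X : finType) (f : L -> X) : locally_constant f ->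
  exists (A : fin_structure) (phi : L -> A),
    [/\ spiral_structures A, @epimorphism LR A phi &
        forall x y, phi x = phi y -> f x = f y].
Proof.
move=> fc; have [_ _ L2 _] := lim.
have [|A [phi [f0 [spA epi fE]]]] := L2 X f.
  by move: fc => /(@continuous_locally_constant L X f).2.
by exists A, phi; split=> // x y xy; rewrite fE /= xy.
Qed.

(** Some map onto [B] exists, and homogeneity moves its composite with [psi] to
[phi]. *)
Lemma limit_lifting (A B : fin_structure) (psi : B -> A) (phi : L -> A) :
    spiral_structures A -> spiral_structures B ->
    @epimorphism B A psi -> @epimorphism LR A phi ->
  exists2 chi : L -> B, @epimorphism LR B chi & forall x, phi x = psi (chi x).
Proof.
move=> spA spB epsi ephi; have [_ L1 _ L3] := lim.
have [chi0 echi0] := L1 B spB.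
have [sigma [[esigma _] phiE]] :=
  L3 A _ phi spA (@epimorphism_comp LR B A _ _ echi0 epsi) ephi.
exists (chi0 \o sigma); first exact: (@epimorphism_comp LR LR B).
by move=> x; rewrite phiE.
Qed.

(** A map that isolates a point factors through a structure all of whose points
have two preimages in another quotient of the limit. *)
Lemma limit_no_isolated_point : no_isolated_point L.
Proof.
move=> x xo; have [_ hL _] := limit_stone_space.
have xc : locally_constant (fun y => `[< [set x] y >]).
  apply: clopen_locally_constant; split=> //.
  exact: (accessible_closed_set1 (hausdorff_accessible hL)).
have [A [phi [spA ephi phix]]] := limit_resolution xc.
have [B [psi [s [spB epsi _ psis]]]] := spiral_splitting spA.
have [chi [_ chis _] phiE] := limit_lifting spA spB epsi ephi.
have onlyx y : phi y = phi x -> y = x.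
  by move=> /phix; rewrite [RHS]asboolT// => /asboolP.
have chix e : s (chi x) = e.
  have [b [bx be]] := psis (phi x) e; have [y yb] := chis b.
  have yx : y = x by apply: onlyx; rewrite phiE yb.
  by rewrite -yx yb.
by have := chix true; rewrite (chix false).
Qed.

(** Two successors of [x] have the same image in every quotient [A], since [A] is
refined by a quotient [B] coherent over it. *)
Lemma limit_functional :
  (forall x y z, R (x, y) -> R (x, z) -> y = z) /\
  (forall x y z, R (x, z) -> R (y, z) -> x = y).
Proof.
have [_ _ [e [ec esep]]] := limit_stone_space.
have equal y z : (forall (A : fin_structure) (phi : L -> A), spiral_structures A ->
    @epimorphism LR A phi -> phi y = phi z) -> y = z.
  move=> yz; apply: esep => n.
  have [A [phi [spA ephi phie]]] := limit_resolution (ec n).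
  by apply: phie; exact: yz.
split=> x y z xy xz; apply: equal => A phi spA ephi.
  have [B [psi [s [spB epsi [psic _] _]]]] := spiral_splitting spA.
  have [chi [_ _ chiR] phiE] := limit_lifting spA spB epsi ephi.
  rewrite !phiE; apply: (psic (chi x)); apply/chiR; [by exists x, y|by exists x, z].
have [B [psi [s [spB epsi [_ psic] _]]]] := spiral_splitting spA.
have [chi [_ _ chiR] phiE] := limit_lifting spA spB epsi ephi.
rewrite !phiE; apply: (psic (chi z)); apply/chiR; [by exists x, z|by exists y, z].
Qed.

Let domain_closed (pr : L * L -> L) : continuous pr -> closed (pr @` R).
Proof.
move=> prc; have [[cL hL _ _ Rc] _ _ _] := lim.
apply: compact_closed => //; apply: continuous_compact.
  exact: continuous_subspaceT.
have cLL : compact [set: L * L] by rewrite -setXTT; exact: compact_setX.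
exact: (subclosed_compact Rc cLL).
Qed.

Let dense_closed (D : set L) : closed D ->
    (forall (A : fin_structure) (phi : L -> A), spiral_structures A ->
      @epimorphism LR A phi -> forall x, exists2 y, D y & phi y = phi x) ->
  forall x, D x.
Proof.
move=> Dc Dd x; have [[cL hL zL _ _] _ _ _] := lim.
apply: contrapT => nDx.
have [V [Vx Vcl] VD] : filter_from [set D : set L | D x /\ clopen D] id (~` D).
  apply: (zero_dimensional_cvg hL zL cL).
  by apply: open_nbhs_nbhs; split=> //; exact: closed_openC.
have [A [phi [spA ephi phiV]]] :=
  limit_resolution (clopen_locally_constant Vcl).
have [y Dy /phiV] := Dd A phi spA ephi x.
by rewrite [RHS]asboolT// => /asboolP/VD.
Qed.

(** The domain and the range of the relation are closed, and they meet every
fibre of every quotient since spirals have successors and predecessors. *)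
Lemma limit_total : (forall x, exists y, R (x, y)) /\ (forall y, exists x, R (x, y)).
Proof.
split=> x.
  suff [[x' y] /= xy <-] : (fst @` R) x by exists y.
  move: x; apply: dense_closed.
    by apply: domain_closed => p; exact: cvg_fst.
  move=> A phi /spiral_structures_dynamics[_ extA _] [_ _ phiR] x.
  have [[a /phiR[y [y' [yx _ yy']]]] _] := extA (phi x).
  by exists y => //; exists (y, y').
suff [[y x'] /= xy <-] : (snd @` R) x by exists y.
move: x; apply: dense_closed.
  by apply: domain_closed => p; exact: cvg_snd.
move=> A phi /spiral_structures_dynamics[_ extA _] [_ _ phiR] x.
have [_ [a /phiR[y [y' [_ yx yy']]]]] := extA (phi x).
by exists y' => //; exists (y, y').
Qed.

Lemma limit_graph :
  exists2 F : L -> L, homeomorphism F & R = [set p | p.2 = F p.1].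
Proof.
have [[cL hL _ _ Rc] _ _ _] := lim.
have [Rl Rr] := limit_total; have [Rfun Rinj] := limit_functional.
exact: closed_bijection_homeomorphism.
Qed.

Lemma limit_cantor : exists h : cantor_space -> L, homeomorphism h.
Proof.
have [x _] : exists x : L, True.
  have [_ L1 _ _] := lim.
  have tt_lc : locally_constant (fun _ : L => tt).
    by move=> x; exact: filterS (@filterT _ (nbhs x) _).
  have [A [phi [spA [_ phis _] _]]] := limit_resolution tt_lc.
  have [[a _] _ _] := spiral_structures_dynamics spA.
  by have [x _] := phis a; exists x.
have [|||h hh _] := @perfect_stone_homeomorphism cantor_space L unit
    (fun=> tt) (fun=> tt) cantor_stone_space limit_stone_space
    cantor_no_isolated_point limit_no_isolated_point.
- by move=> y; exact: filterS (@filterT _ (nbhs y) _).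
- by move=> y; exact: filterS (@filterT _ (nbhs y) _).
- by split=> _; [exists x|exists point].
by exists h.
Qed.

End limit.

(** * Generic homeomorphisms *)

(** The epimorphisms onto [A] for the graph of [G], see
[finite_factor_epimorphism]. *)
Definition finite_factor (T : topologicalType) (G : T -> T) (A : fin_structure)
    (phi : T -> A) :=
  [/\ locally_constant phi, forall a, exists t, phi t = a &
      forall a a', fs_rel a a' <-> exists t, phi t = a /\ phi (G t) = a'].

Lemma finite_factor_epimorphism (T : topologicalType) (G : T -> T) (A : fin_structure)
    (phi : T -> A) :
  @epimorphism (RStructure [set p : T * T | p.2 = G p.1]) A phi <->
  finite_factor G phi.
Proof.
split=> -[phic phis phiR]; split=> //.
- by apply/continuous_locally_constant; exact: phic.
- move=> a a'; split=> [/phiR[t [t' /= [<- <- ->]]]|[t [<- <-]]].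
    by exists t.
  by apply/phiR; exists t, (G t).
- by move: phic => /(@continuous_locally_constant T A phi).2.
- move=> a a'; split=> [/phiR[t /= [<- <-]]|[t [t' /= [<- <- ->]]]].
    by exists t, (G t).
  by apply/phiR; exists t.
Qed.

Lemma finite_factor_comp (T : topologicalType) (G : T -> T) (A B : fin_structure)
    (chi : T -> B) (psi : B -> A) :
  finite_factor G chi -> @epimorphism B A psi -> finite_factor G (psi \o chi).
Proof.
move=> /finite_factor_epimorphism echi epsi; apply/finite_factor_epimorphism.
exact: (@epimorphism_comp (RStructure _) B A).
Qed.

Lemma finite_factor_cancel (T : topologicalType) (G : T -> T) (A B : fin_structure)
    (chi : T -> B) (psi : B -> A) :
  finite_factor G chi -> finite_factor G (psi \o chi) -> @epimorphism B A psi.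
Proof.
move=> [_ chis chiR] [_ phis phiR]; apply/fin_epimorphismP; split.
- by move=> b b' /chiR[t [<- <-]]; apply/phiR; exists t.
- by move=> a; have [t <-] := phis a; exists (chi t).
- move=> a a' /phiR[t [<- <-]]; exists (chi t), (chi (G t)); split=> //.
  by apply/chiR; exists t.
Qed.

(** Structures on ordinals represent all isomorphism types by a countable family,
as needed for the countable intersection below. *)
Definition ord_structure n (r : {ffun 'I_n * 'I_n -> bool}) : fin_structure :=
  @FinStructure 'I_n (fun i j => r (i, j)).

Lemma ord_structure_copy (A : fin_structure) : spiral_structures A ->
  exists n (r : {ffun 'I_n * 'I_n -> bool}) (f : A -> ord_structure r)
      (g : ord_structure r -> A),
    [/\ spiral_structures (ord_structure r), @epimorphism A (ord_structure r) f,
        @epimorphism (ord_structure r) A g & injective f].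
Proof.
move=> [k [S [k0 [phi [ephi phi_bij]]]]].
pose r := [ffun p : 'I_#|A| * 'I_#|A| => fs_rel (enum_val p.1) (enum_val p.2)].
exists #|A|, r, enum_rank, enum_val.
have ef : @epimorphism A (ord_structure r) enum_rank.
  apply/fin_epimorphismP; split=> [b b' bb'|a|a a' aa'].
  - by rewrite /fs_rel /= ffunE !enum_rankK.
  - by exists (enum_val a); rewrite enum_valK.
  - exists (enum_val a), (enum_val a'); rewrite !enum_valK; split=> //.
    by move: aa'; rewrite {1}/fs_rel /= ffunE.
have eg : @epimorphism (ord_structure r) A enum_val.
  apply/fin_epimorphismP; split=> [b b'|a|a a' aa'].
  - by rewrite {1}/fs_rel /= ffunE.
  - by exists (enum_rank a); rewrite enum_rankK.
  - exists (enum_rank a), (enum_rank a'); rewrite !enum_rankK; split=> //.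
    by rewrite /fs_rel /= ffunE !enum_rankK.
split=> //.
exists k, S; split=> //; exists (phi \o enum_val); split.
  exact: (@epimorphism_comp (ord_structure r) A (spiral_union S)).
by apply: bij_comp => //; exists enum_rank.
Qed.

Definition resolving (T : topologicalType) (G : T -> T) (Y : Type)
    (f : T -> Y) :=
  exists n (r : {ffun 'I_n * 'I_n -> bool}) (phi : T -> ord_structure r),
    [/\ spiral_structures (ord_structure r), finite_factor G phi &
        forall x y, phi x = phi y -> f x = f y].

Definition lifting (T : topologicalType) (G : T -> T) (A B : fin_structure)
    (psi : B -> A) (phi : T -> A) :=
  spiral_structures A -> spiral_structures B -> @epimorphism B A psi ->
  finite_factor G phi ->
  exists2 chi : T -> B, finite_factor G chi & forall x, phi x = psi (chi x).

(** The two properties of the limit that the back-and-forth argument uses. Unlike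
homogeneity they do not quantify over homeomorphisms of the space, and each
instance is an open condition on [G]. *)
Definition generic (T : topologicalType) (G : T -> T) :=
  (forall (Y : Type) (f : T -> Y), locally_constant f -> resolving G f) /\
  forall m n (r : {ffun 'I_m * 'I_m -> bool}) (q : {ffun 'I_n * 'I_n -> bool})
    (psi : ord_structure q -> ord_structure r) phi, lifting G psi phi.

Lemma limit_generic (L : topologicalType) (F : L -> L) :
    proj_fraisse_limit spiral_structures
      (RStructure [set p : L * L | p.2 = F p.1]) ->
  generic F.
Proof.
move=> lim; have [cL _ [e es]] := limit_stone_space lim; split.
  move=> Y f fc; have [n fn] := locally_constant_factor cL es fc.
  have [A [phi [spA ephi phif]]] :=
    limit_resolution lim (locally_constant_prefix_code n es).
  have [m [r [c [_ [spr ec _ cinj]]]]] := ord_structure_copy spA.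
  exists m, r, (c \o phi); split=> //.
    by apply: finite_factor_comp ec; exact/finite_factor_epimorphism.
  by move=> x y /= /cinj/phif/fn.
move=> m n r q psi phi spr spq epsi /finite_factor_epimorphism ephi.
have [chi echi phiE] := limit_lifting lim spr spq epsi ephi.
by exists chi => //; exact/finite_factor_epimorphism.
Qed.

(** Some quotient [q] exists; a common refinement of [q] and [r] provided by joint
projection lifts to [T], and maps to [r]. *)
Lemma generic_factor (T : topologicalType) (G : T -> T) m
    (r : {ffun 'I_m * 'I_m -> bool}) :
  generic G -> spiral_structures (ord_structure r) ->
  exists phi : T -> ord_structure r, finite_factor G phi.
Proof.
move=> [Gres Glift] spr.
have [|n [q [phi [spq fphi _]]]] := Gres unit (fun=> tt).
  by move=> x; exact: filterS (@filterT _ (nbhs x) _).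
have [C [spC [[alpha ealpha] [beta ebeta]]]] := spiral_joint_projection spr spq.
have [k [s [_ [d [sps _ ed _]]]]] := ord_structure_copy spC.
have ebd := @epimorphism_comp (ord_structure s) C (ord_structure q) _ _ ed ebeta.
have ead := @epimorphism_comp (ord_structure s) C (ord_structure r) _ _ ed ealpha.
have [chi fchi _] := Glift _ _ _ _ (beta \o d) phi spq sps ebd fphi.
by exists ((alpha \o d) \o chi); exact: finite_factor_comp fchi ead.
Qed.

(** One step of the back-and-forth. The quotient of [T] that decides both [phi]
and [e] maps to [r] by an epimorphism, along which [psi] lifts. *)
Lemma generic_refinement (T S : topologicalType) (F : T -> T) (G : S -> S)
    m (r : {ffun 'I_m * 'I_m -> bool}) (phi : T -> ord_structure r)
    (psi : S -> ord_structure r) (e : T -> bool) :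
    generic F -> generic G -> spiral_structures (ord_structure r) ->
    finite_factor F phi -> finite_factor G psi -> locally_constant e ->
  exists n (q : {ffun 'I_n * 'I_n -> bool}) (phi' : T -> ord_structure q)
      (psi' : S -> ord_structure q),
    [/\ spiral_structures (ord_structure q), finite_factor F phi', finite_factor G psi',
        forall t s, phi' t = psi' s -> phi t = psi s &
        forall t t', phi' t = phi' t' -> e t = e t'].
Proof.
move=> [Fres _] [_ Glift] spr fphi fpsi ec.
have [phic _ _] := fphi.
have [n [q [phi' [spq fphi' phi'E]]]] :=
  Fres _ _ (locally_constant_pair phic ec).
have [_ phi's _] := fphi'; have [sec secK] := choice phi's.
pose rho b := phi (sec b).
have phiE t : phi t = rho (phi' t).
  by have /phi'E[] : phi' t = phi' (sec (phi' t)) by rewrite secK.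
have erho : @epimorphism (ord_structure q) (ord_structure r) rho.
  by apply: (finite_factor_cancel fphi'); rewrite (_ : _ \o _ = phi)//; apply/funext.
have [psi' fpsi' psiE] := Glift _ _ _ _ rho psi spr spq erho fpsi.
exists n, q, phi', psi'; split=> //.
- by move=> t s ts; rewrite phiE psiE ts.
- by move=> t t' /phi'E[].
Qed.

Lemma generic_conjugate (T S : topologicalType) (F : T -> T) (G : S -> S) :
    stone_space T -> stone_space S -> continuous F -> continuous G ->
    generic F -> generic G ->
  exists2 g : T -> S, homeomorphism g & forall t, g (F t) = G (g t).
Proof.
move=> [cT hT [eT eTs]] [cS hS [eS eSs]] Fc Gc Fgen Ggen.
pose M (Q : set (T * S)) :=
  exists m (r : {ffun 'I_m * 'I_m -> bool}) (phi : T -> ord_structure r)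
    (psi : S -> ord_structure r),
  [/\ spiral_structures (ord_structure r), finite_factor F phi, finite_factor G psi &
      Q = [set p | phi p.1 = psi p.2]].
have [|m [r [phi [spr fphi _]]]] := Fgen.1 unit (fun=> tt).
  by move=> x; exact: filterS (@filterT _ (nbhs x) _).
have [psi fpsi] := generic_factor Ggen spr.
have [||||||g [gh gF _]] := @back_and_forth T S F G eT eS M
    [set p | phi p.1 = psi p.2] cT cS hT hS Fc Gc eTs eSs.
- move=> Q [m' [r' [phi' [psi' [_ [? _ _] [? _ _] ->]]]]].
  exact: fiber_product_closed.
- move=> Q [m' [r' [phi' [psi' [_ [_ _ phiR] [_ _ psiR] ->]]]]] t /=.
  have : fs_rel (phi' t) (phi' (F t)) by apply/phiR; exists t.
  by move=> /psiR[s [<- <-]]; exists s.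
- move=> Q [m' [r' [phi' [psi' [_ [_ phis _] _ ->]]]]] s /=.
  by have [t] := phis (psi' s); exists t.
- move=> Q e [m' [r' [phi' [psi' [spr' fphi' fpsi' ->]]]]] ec.
  have [n [q [phi2 [psi2 [spq fphi2 fpsi2 sub e2]]]]] :=
    generic_refinement Fgen Ggen spr' fphi' fpsi' ec.
  exists [set p | phi2 p.1 = psi2 p.2]; first by exists n, q, phi2, psi2.
  split=> [[t s] /=|t t' s /= ts t's]; first exact: sub.
  by apply: e2; rewrite ts.
- move=> Q e [m' [r' [phi' [psi' [spr' fphi' fpsi' ->]]]]] ec.
  have [n [q [psi2 [phi2 [spq fpsi2 fphi2 sub e2]]]]] :=
    generic_refinement Ggen Fgen spr' fpsi' fphi' ec.
  exists [set p | phi2 p.1 = psi2 p.2]; first by exists n, q, phi2, psi2.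
  split=> [[t s] /= ts|t s s' /= ts ts']; first exact/esym/sub/esym.
  by apply: e2; rewrite -ts.
- by exists m, r, phi, psi.
by exists g.
Qed.

Lemma finite_factor_transport (T S : topologicalType) (F : T -> T) (G : S -> S)
    (g : T -> S) (g' : S -> T) (A : fin_structure) (phi : S -> A) :
    continuous g -> cancel g g' -> cancel g' g ->
    (forall t, g (F t) = G (g t)) -> finite_factor G phi ->
  finite_factor F (phi \o g).
Proof.
move=> gc gK g'K gF [phic phis phiR]; split.
- exact: locally_constant_precomp.
- by move=> a; have [s <-] := phis a; exists (g' s); rewrite /= g'K.
- move=> a a'; split=> [/phiR[s [<- <-]]|[t [<- <-]]].
    by exists (g' s); rewrite /= gF g'K.
  by apply/phiR; exists (g t); rewrite /= gF.
Qed.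

Lemma generic_transport (T S : topologicalType) (F : T -> T) (G : S -> S)
    (g : T -> S) (g' : S -> T) :
    continuous g -> continuous g' -> cancel g g' -> cancel g' g ->
    (forall t, g (F t) = G (g t)) -> generic F ->
  generic G.
Proof.
move=> gc g'c gK g'K gF [Fres Flift].
have g'G s : g' (G s) = F (g' s) by rewrite -{1}(g'K s) -gF gK.
split=> [Y f fc|m n r q psi phi spr spq epsi fphi].
  have [m [r [phi [spr fphi phif]]]] := Fres _ _ (locally_constant_precomp fc gc).
  exists m, r, (phi \o g'); split=> //.
    exact: finite_factor_transport g'c g'K gK g'G fphi.
  by move=> x y /phif /=; rewrite !g'K.
have fphi' := finite_factor_transport gc gK g'K gF fphi.
have [chi fchi chiE] := Flift _ _ _ _ psi _ spr spq epsi fphi'.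
exists (chi \o g'); first exact: finite_factor_transport g'c g'K gK g'G fchi.
by move=> x; rewrite /= -chiE /= g'K.
Qed.

Lemma homeomorphism_comp (T S U : topologicalType) (f : T -> S) (g : S -> U) :
  homeomorphism f -> homeomorphism g -> homeomorphism (g \o f).
Proof.
move=> [fc [f' [f'c fK f'K]]] [gc [g' [g'c gK g'K]]]; split.
  by move=> x; apply: continuous_comp; [exact: fc|exact: gc].
exists (f' \o g'); split.
- by move=> x; apply: continuous_comp; [exact: g'c|exact: f'c].
- by move=> x /=; rewrite gK fK.
- by move=> x /=; rewrite f'K g'K.
Qed.

(** Each [O n] contains the dense set [C], so its complement is closed without
interior. *)
Lemma comeager_dense_Gdelta (T : topologicalType) (C : set T)
    (O : nat -> set T) :
    (forall n, open (O n)) -> dense C -> C = \bigcap_n O n -> comeager C.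
Proof.
move=> Oo Cd CE; exists (fun n => ~` O n); split; last first.
  by rewrite CE setC_bigcap.
move=> n; rewrite /nowhere_dense.
have /closure_id <- : closed (~` O n) by exact: open_closedC.
apply/seteqP; split=> // x xO.
have [|y [yO]] := Cd _ _ (open_interior (~` O n)); first by exists x.
rewrite CE => /(_ n I); exact: (interior_subset yO).
Qed.

(** * Uniform convergence in the homeomorphism group *)

Section homeo_group.
Variable L : uniformType.
Hypothesis stL : stone_space L.

Definition homeo_of (f : L -> L) (fh : homeomorphism f) : homeo_group L :=
  exist _ (f : {uniform L -> L}) (mem_set (fh : homeo_group L f)).

Lemma homeo_funP (G : homeo_group L) : homeomorphism (homeo_fun G).
Proof. exact: set_mem (valP G). Qed.

(** Uniform continuity on a compact space. *)
Lemma fiber_entourage (X : Type) (phi : L -> X) : locally_constant phi ->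
  entourage [set p : L * L | phi p.1 = phi p.2].
Proof.
move=> phic; have [cL _ _] := stL.
have [[x0 _]|noL] := pselect (exists x : L, True); last first.
  apply: filterS (@entourageT L) => -[x y] _.
  by exfalso; apply: noL; exists x.
have properL : ProperFilter (@entourage L).
  apply: Build_ProperFilter_ex => A entA.
  by exists (x0, x0); exact: entourage_refl.
pose P (E : set (L * L)) x := forall y, E (x, y) -> phi x = phi y.
have PS (A : set L) (E E' : set (L * L)) :
    E `<=` E' -> A `<=` P E' -> A `<=` P E.
  by move=> EE' AE' x Ax y /EE'; exact: AE'.
have : \forall E \near powerset_filter_from (@entourage L), [set: L] `<=` P E.
  apply: ((compact_near_coveringP _).1 cL _ _ _ (powerset_filter_from_filter _)).
  move=> x _.
  have [E0 E0ent E0x] := (nbhsP _ _).1 (phic x).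
  exists (xsection (split_ent E0) x, [set E | E `<=` split_ent E0]) => /=.
    split; first exact: nbhs_entourage.
    apply/near_powerset_filter_fromP; first by move=> ? ?; exact: subset_trans.
    by exists (split_ent E0).
  move=> [x' E] /= [/xsectionP xx' EE0] y /EE0 x'y.
  have /E0x /= -> : xsection E0 x y.
    by apply/xsectionP; exact: entourage_split xx' x'y.
  apply/E0x/xsectionP; exact: (split_ent_subset E0ent xx').
move=> /near_powerset_filter_fromP[|E Eent EP]; first exact: PS.
by apply: filterS Eent => -[x y] /= Exy; exact: (EP x I).
Qed.

(** The source of all open conditions: [phi \o G] does not change under small
perturbations of [G]. *)
Lemma near_homeo (X : Type) (phi : L -> X) (G : homeo_group L) :
    locally_constant phi ->
  \forall G' \near G, forall x, phi (homeo_fun G' x) = phi (homeo_fun G x).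
Proof.
move=> phic.
have valc : continuous (set_val : homeo_group L -> {uniform L -> L}).
  exact: initial_continuous.
have : nbhs (set_val G) [set f : {uniform L -> L} |
    forall y, phi (homeo_fun G y) = phi (f y)].
  apply/uniform_nbhs; exists [set p : L * L | phi p.1 = phi p.2].
  by split; [exact: fiber_entourage|move=> f /= fG y; exact: fG].
move=> /valc GG.
have sub : (set_val : homeo_group L -> _) @^-1` [set f : {uniform L -> L} |
    forall y, phi (homeo_fun G y) = phi (f y)] `<=`
  [set G' | forall x, phi (homeo_fun G' x) = phi (homeo_fun G x)].
  by move=> G' /= GG' x; exact/esym/GG'.
exact: (@filterS (homeo_group L) (nbhs G) _ _ _ sub GG).
Qed.

(** The entourage that defines the neighbourhood contains the kernel of a fine
clopen partition. *)
Lemma homeo_nbhs (e : nat -> L -> bool) (G : homeo_group L)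
    (U : set (homeo_group L)) : separating e -> nbhs G U ->
  exists n, forall G' : homeo_group L,
    (forall x, prefix_code e n (homeo_fun G' x) =
               prefix_code e n (homeo_fun G x)) -> U G'.
Proof.
move=> es; rewrite nbhsE => -[B [[V Vo VB] BG] BU].
have VG : V (set_val G) by rewrite -VB in BG.
have /uniform_nbhs[E [Eent EV]] : nbhs (set_val G : {uniform L -> L}) V.
  exact: open_nbhs_nbhs.
have [cL _ _] := stL.
have [||n nP] := separating_cofinal (U := interior E) cL es.
- exact: open_interior.
- move=> x; pose E1 := split_ent E `&` ((split_ent E)^-1)%relation.
  have E1ent : entourage E1 by exact: entourage_invI.
  exists (xsection E1 x, xsection E1 x).
    by split; exact: nbhs_entourage.
  move=> [y z] /= [/xsectionP[_ yx] /xsectionP[xz _]].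
  exact: entourage_split yx xz.
exists n => G' G'G; apply: BU; rewrite -VB; apply: EV => x _.
by apply: interior_subset; apply: nP; exact/esym/G'G.
Qed.

End homeo_group.

(** * The conjugacy class of a generic homeomorphism *)

Lemma finite_factor_congr (T : topologicalType) (G G' : T -> T) (A : fin_structure)
    (phi : T -> A) :
  (forall x, phi (G' x) = phi (G x)) -> finite_factor G phi -> finite_factor G' phi.
Proof.
move=> GG' [phic phis phiR]; split=> // a a'.
split=> [/phiR|] [t [ta ta']]; first by exists t; rewrite GG'.
by apply/phiR; exists t; rewrite -GG'.
Qed.

(** A countable type of lifting problems: two structures on [p.1.1] and [p.1.2]
points, a map from the second to the first, and a map from the space to the
first that only depends on the first [p.2] terms of a separating sequence. *)
Definition lifting_index := {p : nat * nat * nat &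
  ({ffun 'I_p.1.1 * 'I_p.1.1 -> bool} * {ffun 'I_p.1.2 * 'I_p.1.2 -> bool} *
   {ffun 'I_p.1.2 -> 'I_p.1.1} *
   {ffun {ffun 'I_p.2 -> bool} -> 'I_p.1.1})%type}.

Section generic_elements.
Variable L : uniformType.
Hypothesis stL : stone_space L.
Variable e : nat -> L -> bool.
Hypothesis es : separating e.

Lemma near_resolving (G : homeo_group L) (Y : Type) (f : L -> Y) :
    resolving (homeo_fun G) f ->
  nbhs G [set G' : homeo_group L | resolving (homeo_fun G') f].
Proof.
move=> [m [r [phi [spr fphi phif]]]]; have [phic _ _] := fphi.
have sub : [set G' : homeo_group L |
      forall x, phi (homeo_fun G' x) = phi (homeo_fun G x)] `<=`
    [set G' : homeo_group L | resolving (homeo_fun G') f].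
  move=> G' /= GG'; exists m, r, phi; split=> //.
  exact: finite_factor_congr fphi.
exact: (@filterS (homeo_group L) (nbhs G) _ _ _ sub (near_homeo stL G phic)).
Qed.

(** If the lifting problem is a genuine one for [G], its solution remains one
nearby; otherwise it is not a genuine one nearby either. *)
Lemma near_lifting (G : homeo_group L) (A B : fin_structure) (psi : B -> A)
    (phi : L -> A) :
    locally_constant phi -> lifting (homeo_fun G) psi phi ->
  nbhs G [set G' : homeo_group L | lifting (homeo_fun G') psi phi].
Proof.
move=> phic lift.
have [[spA spB epsi fphi]|none] := pselect [/\ spiral_structures A,
    spiral_structures B, @epimorphism B A psi & finite_factor (homeo_fun G) phi].
  have [chi fchi chiE] := lift spA spB epsi fphi; have [chic _ _] := fchi.
  have sub : [set G' : homeo_group L |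
        forall x, chi (homeo_fun G' x) = chi (homeo_fun G x)] `<=`
      [set G' : homeo_group L | lifting (homeo_fun G') psi phi].
    move=> G' /= GG' _ _ _ _; exists chi => //; exact: finite_factor_congr fchi.
  exact: (@filterS (homeo_group L) (nbhs G) _ _ _ sub (near_homeo stL G chic)).
have sub : [set G' : homeo_group L |
      forall x, phi (homeo_fun G' x) = phi (homeo_fun G x)] `<=`
    [set G' : homeo_group L | lifting (homeo_fun G') psi phi].
  move=> G' /= GG' spA spB epsi fphi; exfalso; apply: none; split=> //.
  by apply: finite_factor_congr fphi => x; rewrite GG'.
exact: (@filterS (homeo_group L) (nbhs G) _ _ _ sub (near_homeo stL G phic)).
Qed.

Definition lifts_along (G : L -> L) (i : lifting_index) : Prop :=
  let: existT p (r, q, psi, f) := i in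
  @lifting L G (ord_structure r) (ord_structure q) psi
    (fun x => f (prefix_code e p.2 x)).

Definition generic_level n : set (homeo_group L) :=
  [set G | resolving (homeo_fun G) (prefix_code e n) /\
     if unpickle n is Some i then lifts_along (homeo_fun G) i else True].

Lemma generic_level_open n : open (generic_level n).
Proof.
rewrite openE => G [res lift].
suff liftO : nbhs G [set G' : homeo_group L |
    if unpickle n is Some i then lifts_along (homeo_fun G') i else True].
  exact: (@filterI (homeo_group L) (nbhs G) _ _ _ (near_resolving res) liftO).
case: unpickle lift => [[p [[[r q] psi] f]]|] lift; last first.
  exact: (@filterT (homeo_group L) (nbhs G) _).
apply: near_lifting lift.
exact: (locally_constant_comp f (locally_constant_prefix_code p.2 es)).
Qed.

(** The countably many conditions suffice because every locally constant map
factors through some [prefix_code e n]. *)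
Lemma generic_levelP (G : homeo_group L) :
  generic (homeo_fun G) <-> forall n, generic_level n G.
Proof.
split=> [[res lift] n|levels].
  split; first by apply: res; exact: locally_constant_prefix_code.
  by case: unpickle => // -[p [[[r q] psi] f]]; exact: lift.
have [cL _ _] := stL; split=> [Y f fc|m n r q psi phi spr spq epsi fphi].
  have [n fn] := locally_constant_factor cL es fc.
  have [[m [r [phi [spr fphi phie]]]] _] := levels n.
  by exists m, r, phi; split=> // x y /phie/fn.
have [phic _ _] := fphi.
have [l phil] := locally_constant_factor cL es phic.
have [[a0 _] _ _] := spiral_structures_dynamics spr.
have /choice[f fP] (v : {ffun 'I_l -> bool}) : exists a : ord_structure r,
    forall x, prefix_code e l x = v -> phi x = a.
  have [[x <-]|nx] := pselect (exists x, prefix_code e l x = v).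
    by exists (phi x) => y; exact: phil.
  (* Words that are not codes of points are sent to an arbitrary point. *)
  by exists a0 => x xv; exfalso; apply: nx; exists x.
pose i : lifting_index := existT _ (m, n, l)
  (r, q, [ffun b : 'I_n => psi b : 'I_m], [ffun v => f v : 'I_m]).
have [_] := levels (pickle i); rewrite pickleK /=.
have -> : (fun x => [ffun v => f v : 'I_m] (prefix_code e l x)) = phi.
  by apply/funext => x; rewrite ffunE; apply/esym/fP.
have -> : ([ffun b : 'I_n => psi b : 'I_m] : 'I_n -> 'I_m) = psi.
  by apply/funext => b; rewrite ffunE.
exact.
Qed.

Lemma conjugacy_classP (F G : homeo_group L) :
  conjugacy_class F G <->
  exists2 g : L -> L, homeomorphism g &
    forall x, g (homeo_fun F x) = homeo_fun G (g x).
Proof.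
split=> [[g [ginv [gK ginvK GE]]]|[g gh gF]].
  exists (homeo_fun g); first exact: homeo_funP.
  by move=> x; rewrite GE /= gK.
have [gc [g' [g'c gK g'K]]] := gh.
have g'h : homeomorphism g' by split=> //; exists g.
exists (homeo_of gh), (homeo_of g'h); split=> //.
by apply/funext => x /=; rewrite /homeo_fun /= gF g'K.
Qed.

Lemma generic_conjugacy_class (F : homeo_group L) :
  generic (homeo_fun F) ->
  conjugacy_class F = [set G : homeo_group L | generic (homeo_fun G)].
Proof.
move=> Fgen; apply/seteqP; split=> G /=.
  move=> /conjugacy_classP[g [gc [g' [g'c gK g'K]]] gF].
  exact: generic_transport gc g'c gK g'K gF Fgen.
move=> Ggen; apply/conjugacy_classP.
have [Fc _] := homeo_funP F; have [Gc _] := homeo_funP G.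
exact: generic_conjugate.
Qed.

End generic_elements.

(** The pairs [(f x, f (G x))] form a finite graph, with an edge for each step of
[G]; the orbits of [G] are arbitrarily long walks through each of its edges.
The pairs, rather than the values of [f], are taken as points so that a point
already determines where [f] goes next. *)
Lemma spiral_structure_over_homeomorphism (T : topologicalType) (X : finType)
    (G G' : T -> T) (f : T -> X) (x0 : T) : cancel G' G ->
  exists (C : fin_structure) (k : C -> X * X),
    [/\ spiral_structures C, forall x, exists c, k c = (f x, f (G x)),
        forall c, exists x, k c = (f x, f (G x)) &
        forall c c', fs_rel c c' -> (k c').1 = (k c).2].
Proof.
move=> G'K; pose h x := (f x, f (G x)).
pose E (d d' : X * X) := exists x, h x = d /\ h (G x) = d'.
have win K x : window E K (h x) (h (G x)).
  exists (fun t => h (iter t G (iter K G' x))); first by move=> t _; eexists.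
  have iterK y : iter K G (iter K G' y) = y.
    by elim: K y => // K IHK y; rewrite iterSr [iter K.+1 G' y]/= G'K IHK.
  by rewrite /= iterK.
have [|C [k [spC kE _ kw]]] := @spiral_cover (X * X)%type E.
  by exists (h x0), (h (G x0)); exact: win.
have [_ extC _] := spiral_structures_dynamics spC.
exists C, k; split=> //.
- by move=> x; have [c [_ [_ hc _]]] := kw _ _ (win _ x); exists c.
- by move=> c; have [[c' /kE[x [<- _]]] _] := extC c; exists x.
- by move=> c c' /kE[x [<- <-]].
Qed.

(** Let [eta0] be an epimorphism of the limit onto the structure covering the
graph that describes [G] up to the partition [f]. The map [k \o eta0] and the
map [x |-> (f x, f (G x))] have the same values, so a homeomorphism [g] carries
one to the other, and then [g \o F \o g^-1] agrees with [G] up to [f]. *)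
Lemma limit_conjugacy_class_dense (L : uniformType) (F : homeo_group L) :
    proj_fraisse_limit spiral_structures
      (RStructure [set p : L * L | p.2 = homeo_fun F p.1]) ->
  dense (conjugacy_class F).
Proof.
move=> lim U [G UG] Uo; have stL := limit_stone_space lim.
have [_ _ [e es]] := stL.
have [n nU] := homeo_nbhs stL es (open_nbhs_nbhs (conj Uo UG)).
have perfL := limit_no_isolated_point lim.
set f := prefix_code e n in nU.
have fc : locally_constant f by exact: locally_constant_prefix_code.
have [Gc [G' [_ _ G'K]]] := homeo_funP G.
have [h0 _] := limit_cantor lim.
have [C [k [spC kh hk kR]]] :=
  spiral_structure_over_homeomorphism f (h0 point) G'K.
have [_ L1 _ _] := lim.
have [eta0 /finite_factor_epimorphism[eta0c eta0s eta0R]] := L1 C spC.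
have [|||g gh gE] := @perfect_stone_homeomorphism L L _ (k \o eta0)
    (fun x => (f x, f (homeo_fun G x))) stL stL perfL perfL.
- exact: locally_constant_comp.
- apply: locally_constant_pair => //; exact: locally_constant_precomp.
- split=> [t|x]; first by have [x] := hk (eta0 t); exists x.
  have [c cx] := kh x; have [t tc] := eta0s c.
  by exists t; rewrite /= tc cx.
have [gc [g' [g'c gK g'K]]] := gh.
have Hh : homeomorphism (g \o homeo_fun F \o g').
  apply: homeomorphism_comp; first by split=> //; exists g.
  by apply: homeomorphism_comp => //; exact: homeo_funP.
exists (homeo_of Hh); split.
  apply: nU => x; rewrite -[x]g'K; move: (g' x) => q.
  rewrite /homeo_fun /= gK.
  have : fs_rel (eta0 q) (eta0 (homeo_fun F q)) by apply/eta0R; exists q.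
  by move=> /kR; rewrite [k _]gE [X in _ = X.2 -> _]gE.
apply/conjugacy_classP; exists g => //.
by move=> x; rewrite /homeo_fun /= gK.
Qed.

Theorem theorem3p1 :
  proj_fraisse_family spiral_structures /\
  forall (L : uniformType) (RL : set (L * L)),
    proj_fraisse_limit spiral_structures (RStructure RL) ->
    (exists h : cantor_space -> L, homeomorphism h) /\
    exists F : homeo_group L,
      RL = [set p | p.2 = homeo_fun F p.1] /\
      comeager (conjugacy_class F).
Proof.
split.
  by split; [exact: spiral_joint_projection|exact: spiral_amalgamation].
move=> L RL lim; split; first exact: limit_cantor lim.
have [F Fh RE] := limit_graph lim; exists (homeo_of Fh); split=> //.
rewrite RE in lim; have stL := limit_stone_space lim.
have [_ _ [e es]] := stL.
apply: (@comeager_dense_Gdelta _ _ (@generic_level L e)).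
- by move=> n; exact: generic_level_open.
- exact: limit_conjugacy_class_dense.
rewrite generic_conjugacy_class//; last exact: limit_generic lim.
apply/seteqP; split=> G /=.
  by move=> /(generic_levelP stL es) H n _; exact: H.
by move=> H; apply/(generic_levelP stL es) => n; exact: H.
Qed.
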